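(* Let $\Lambda\leq \Gamma$ be a coamenable inclusion of countable groups. Suppose $(X,\mu)$ is a standard probability space and $\Gamma\curvearrowright (X,\mu)$ is a strongly ergodic probability measure-preserving action. Then $\Lambda\curvearrowright (X,\mu)$ has countably many ergodic components, each of which is strongly ergodic. That is, there are a countable set $I$ and a partition (modulo null sets) $(E_i)_{i\in I}$ of $X$ into $\Lambda$-invariant measurable sets of positive measure such that for each $i\in I$ the action $\Lambda\curvearrowright (E_i,\mu(E_i\cap\cdot)/\mu(E_i))$ is ergodic and strongly ergodic.
   Context: An inclusion $\Lambda\leq\Gamma$ of countable groups is coamenable if there is a $\Gamma$-invariant mean (finitely additive probability measure) on the coset space $\Gamma/\Lambda$. A probability measure-preserving action $\Gamma\curvearrowright(X,\mu)$ of a countable group is strongly ergodic if whenever $(E_n)_n$ is a sequence of measurable subsets of $X$ with $\mu(gE_n\Delta E_n)\to 0$ for all $g\in\Gamma$, then $\mu(E_n)(1-\mu(E_n))\to 0$. The action is not assumed essentially free. *)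

(* Defs.v *)
From HB Require Import structures.
From mathcomp Require Import all_boot all_order all_algebra.
From mathcomp Require Import all_classical all_reals all_analysis.

Set Implicit Arguments.
Unset Strict Implicit.
Unset Printing Implicit Defensive.

Import Order.TTheory GRing.Theory Num.Theory.
Import numFieldNormedType.Exports.

Local Open Scope classical_set_scope.
Local Open Scope ring_scope.

Definition subgroup (G : groupType) (L : set G) : Prop :=
  group_closed (mem L).

Definition ltranslate (G : groupType) (g : G) (C : set G) : set G :=
  [set (g * x)%g | x in C].

Definition coset_space (G : groupType) (L : set G) : set (set G) :=
  [set ltranslate g L | g in [set: G]].

(* Only the values of [m] on subsets of [S] are constrained. *)
Definition mean_on (R : realType) (T : Type) (S : set T) (m : set T -> R) :
    Prop :=
  [/\ m S = 1,
      forall A, A `<=` S -> 0 <= m A &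
      forall A B, A `<=` S -> B `<=` S -> A `&` B = set0 ->
        m (A `|` B) = m A + m B].

Definition coamenable (R : realType) (G : groupType) (L : set G) : Prop :=
  exists2 m : set (set G) -> R, mean_on (coset_space L) m &
    forall (g : G) A, A `<=` coset_space L -> m (ltranslate g @` A) = m A.

(* The sigma-algebra of [X] is the Borel sigma-algebra of a Polish topology;
   a Hausdorff pseudometric space is a metric space, and a metric space is
   separable iff it is second countable. *)
Definition standard_borel (R : realType) (d : measure_display)
    (X : measurableType d) : Prop :=
  exists (P : completePseudoMetricType R) (f : X -> P),
    [/\ bijective f, hausdorff_space P, @second_countable P &
        forall B : set P, <<s open >> B <-> measurable (f @^-1` B)].

Section actions.
Context (R : realType) (G : groupType) (d : measure_display).
Context (X : measurableType d).
Implicit Types (act : G -> X -> X) (H : set G) (D A : set X).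
Implicit Types (nu : set X -> \bar R).

Record pmp_action (mu : probability X R) act : Prop := PmpAction {
  pmp_act1 : forall x, act 1%g x = x;
  pmp_actM : forall g h x, act (g * h)%g x = act g (act h x);
  pmp_measurable : forall g, measurable_fun [set: X] (act g);
  pmp_preserving : forall g A, measurable A -> mu (act g @^-1` A) = mu A }.

Definition invariant_set act H A : Prop := forall g, H g -> act g @` A = A.

(* The next two notions concern the action of [H] on the probability space
   [(D, nu)], where [D] is an [H]-invariant measurable set. *)
Definition ergodic act H D nu : Prop :=
  forall A, measurable A -> A `<=` D ->
    (forall g, H g -> nu ((act g @` A) `+` A) = 0%E) ->
    nu A = 0%E \/ nu A = 1%E.

Definition strongly_ergodic act H D nu : Prop :=
  forall E : nat -> set X,
    (forall n, measurable (E n)) -> (forall n, E n `<=` D) ->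
    (forall g, H g -> nu ((act g @` E n) `+` E n) @[n --> \oo] --> 0%E) ->
    (nu (E n) * (1 - nu (E n)))%E @[n --> \oo] --> 0%E.

Definition normalized_restriction (mu : probability X R) D :
    set X -> \bar R :=
  fun A => (mu (D `&` A) / mu D)%E.

End actions.

(* Main.v *)
Require Import Defs.
From HB Require Import structures.
From mathcomp Require Import all_boot all_order all_algebra.
From mathcomp Require Import finmap.
From mathcomp Require Import all_classical all_reals all_analysis.
From mathcomp Require Import measurable_realfun.
From mathcomp Require Import zify lra.

Set Implicit Arguments.
Unset Strict Implicit.
Unset Printing Implicit Defensive.

Import Order.TTheory GRing.Theory Num.Theory.
Import numFieldNormedType.Exports.

Local Open Scope classical_set_scope.
Local Open Scope ring_scope.

(** Two facts combine.

    From small pieces to almost invariant sets.  A coamenable inclusion has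
    finite Foelner sets of cosets.  Let [s] list representatives of such a set
    and let [p] be an almost [L]-invariant set.  Up to a small error, the
    translate [act (s c) @` p] depends only on the coset of [s c], so the
    function counting the translates that contain a point is almost
    [G]-invariant, and so are its level sets, on average over the levels.  A
    level set may have any measure, so a single [p] says nothing.  But take
    many disjoint almost [L]-invariant sets [p i], each much smaller than the
    inverse of the size of the Foelner set, with total mass bounded below.
    Their level sets are small, and each can be chosen so that its defect of
    invariance is small compared with the mass that it adds to the union of
    those already chosen ([greedy_union]); the union then reaches an
    intermediate measure while staying almost [G]-invariant.  This contradicts
    strong ergodicity of [G] ([no_thin_families]).

    Compactness.  If almost [L]-invariant sets were not totally bounded for the
    distance [mu (A `+` B)], finitely many pairwise distant ones would generate
    a partition whose small cells carry a definite mass, by the pigeonhole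
    principle: a family that was just excluded.  Hence ([close_pair]) almost
    [L]-invariant sets are uniformly totally bounded, and along any ultrafilter
    a sequence of asymptotically [L]-invariant sets converges to an
    [L]-invariant set ([ultra_cvg_invariant]).

    The theorem follows.  A set of positive measure without ergodic component
    would split into invariant pieces of arbitrarily small measure, which is
    excluded ([no_diffuse_part]); thus countably many ergodic components
    exhaust [X].  In an ergodic component [D], asymptotically invariant subsets
    converge along every ultrafilter to an invariant subset of [D], whose
    measure is [0] or that of [D]: this is strong ergodicity of [D]. *)

(** * Hall's marriage theorem *)

(** Rado's proof: as long as some [A i0] has two elements, one of the two can be
    removed.  Otherwise each removal violates the condition at some set of
    indices, and submodularity of the size of the union gives a violation at
    their union or at their intersection minus [i0]. *)
Lemma hall_finite (I : finType) (T : choiceType) (A : I -> {fset T}) :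
  (forall J : {set I}, #|J| <= #|` \bigcup_(i in J) A i|%fset)%N ->
  exists2 f : I -> T, injective f & forall i, f i \in A i.
Proof.
have [n] := ubnP (\sum_i #|` A i|)%N; elim: n A => // n IHn A ltAn hallA.
have [/existsP[i0 i0P]|] := boolP [exists i, (1 < #|` A i|)%N]; last first.
  rewrite negb_exists => /forallP small.
  have A1 i : exists x, A i = [fset x]%fset.
    have := hallA [set i]%SET; rewrite cards1 big_set1 => Ai.
    by apply/cardfs1P; rewrite eqn_leq Ai leqNgt small.
  pose f i := projT1 (cid (A1 i)); have fE i : A i = [fset f i]%fset.
    exact: projT2 (cid (A1 i)).
  exists f => [i j fij|i]; last by rewrite fE inE.
  apply/eqP; apply/negPn/negP => neqij.
  have := hallA [set i; j]%SET; rewrite cards2 neqij big_setU1 ?inE//= big_set1.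
  by rewrite !fE fij fsetUid cardfs1.
have [x xA] : exists x, x \in A i0.
  by apply/fset0Pn; rewrite -cardfs_gt0; apply: ltn_trans i0P.
have [y /andP[yx yA]] : exists y, (y != x) && (y \in A i0).
  have /fset0Pn[y] : (A i0 `\ x != fset0)%fset.
    by rewrite -cardfs_gt0; move: i0P; rewrite (cardfsD1 x) xA.
  by rewrite !inE => yP; exists y.
pose B z i := if i == i0 then (A i `\ z)%fset else A i.
have BA z i : (B z i `<=` A i)%fset.
  by rewrite /B; case: ifP => _; [exact: fsubsetDl|exact: fsubset_refl].
have reduce z : z \in A i0 ->
    (forall J : {set I}, #|J| <= #|` \bigcup_(i in J) B z i|%fset)%N ->
    exists2 f : I -> T, injective f & forall i, f i \in A i.
  move=> zA hallB; have [|f injf fB] := IHn (B z) _ hallB; last first.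
    by exists f => // i; apply: (fsubsetP (BA z i)).
  rewrite -ltnS; apply: leq_trans ltAn; rewrite ltnS.
  rewrite (bigD1 i0)//= [X in (_ < X)%N](bigD1 i0)//= {1}/B eqxx.
  rewrite [in X in (_ < X)%N](cardfsD1 z) zA -addSn leq_add//.
  by apply: leq_sum => i _; apply: fsubset_leq_card.
have [|/existsNP[J1 /negP]] :=
  pselect (forall J : {set I}, #|J| <= #|` \bigcup_(i in J) B x i|%fset)%N.
  exact: reduce.
have [|/existsNP[J2 /negP]] :=
  pselect (forall J : {set I}, #|J| <= #|` \bigcup_(i in J) B y i|%fset)%N.
  by move=> hallB _; apply: (reduce y).
rewrite -!ltnNge => lt2 lt1; exfalso.
have mem z (J : {set I}) : (#|` \bigcup_(i in J) B z i|%fset < #|J|)%N -> i0 \in J.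
  rewrite ltnNge => /negP nle; apply/negPn/negP => i0J; apply: nle.
  apply: leq_trans (hallA J) _; rewrite (eq_bigr (B z))// => i iJ.
  by rewrite /B; case: eqP iJ => // ->; rewrite (negbTE i0J).
have i1 := mem _ _ lt1; have i2 := mem _ _ lt2.
set N1 := (\bigcup_(i in J1) _)%fset in lt1.
set N2 := (\bigcup_(i in J2) _)%fset in lt2.
have leU : (#|J1 :|: J2| <= #|` N1 `|` N2|%fset)%N.
  apply: leq_trans (hallA _) _; apply: fsubset_leq_card.
  apply/fsubsetP => t /bigfcupP[i /andP[_]]; rewrite !inE => iJ tA.
  have [ei|nei] := eqVneq i i0.
    have [tx|tx] := eqVneq t x.
      apply/orP; right; apply/bigfcupP; exists i0; rewrite ?mem_index_enum//.
      by rewrite /B eqxx !inE tx eq_sym yx xA.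
    apply/orP; left; apply/bigfcupP; exists i0; rewrite ?mem_index_enum//.
    by rewrite /B eqxx !inE tx -ei.
  case/orP: iJ => iJ; apply/orP; [left|right];
  by apply/bigfcupP; exists i; rewrite ?mem_index_enum//= /B (negbTE nei).
have leI : (#|(J1 :&: J2) :\ i0| <= #|` N1 `&` N2|%fset)%N.
  apply: leq_trans (hallA _) _; apply: fsubset_leq_card.
  apply/fsubsetP => t /bigfcupP[i /andP[_]]; rewrite !inE => /and3P[nei iJ1 iJ2] tA.
  apply/andP; split; apply/bigfcupP; exists i;
  by rewrite ?mem_index_enum//= /B (negbTE nei).
have := cardsUI J1 J2; have := cardfsUI N1 N2.
rewrite [#|J1 :&: J2|](cardsD1 i0) inE i1 i2 /=.
rewrite /= in leI leU *; lia.
Qed.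

Lemma ultra_finite (T : Type) (U : choiceType) (F : set_system T)
    (D : {fset U}) (f : T -> U) :
  UltraFilter F -> F [set x | f x \in D] ->
  exists2 u, u \in D & F [set x | f x = u].
Proof.
move=> FU FD; apply: contrapT => noD.
have FF : ProperFilter F by exact: ultra_proper.
have : F ([set x | f x \in D] `&`
    \bigcap_(u in [set` D]) [set x | f x <> u]).
  apply: filterI => //; apply: filter_bigI => u uD.
  have [Fu|//] := in_ultra_setVsetC [set x | f x = u] FU.
  by exfalso; apply: noD; exists u.
by move/filter_ex => [x [/= xD xN]]; apply: (xN (f x)).
Qed.

(** Compactness extends Hall's theorem to infinitely many finite sets: the
    matchings of finite sets of indices converge along an ultrafilter that
    contains, for each finite set of indices, all larger ones. The element [t0]
    is the value of the matching outside [D]. *)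
Lemma hall (I T : choiceType) (t0 : T) (D : set I) (A : I -> {fset T}) :
  (forall J : {fset I}, [set` J] `<=` D ->
     #|` J| <= #|` \bigcup_(i <- J) A i|%fset)%N ->
  exists2 f : I -> T, (forall i, D i -> f i \in A i) &
    (forall i j, D i -> D j -> f i = f j -> i = j).
Proof.
move=> hallA.
have sel (J : {fset I}) : exists f : I -> option T,
    forall i, i \in J -> D i ->
      (exists2 t, f i = Some t & t \in A i) /\
      forall j, j \in J -> D j -> f i = f j -> i = j.
  pose JD := [fset i in J | i \in D]%fset.
  have [K|f injf fA] := @hall_finite JD T (fun i => A (val i)).
    have := hallA [fset val i | i in K]%fset _.
    rewrite card_imfset /=; last exact: val_inj.
    rewrite -cardE => le; apply: leq_trans (le _) _.
      move=> i /= /imfsetP[/= j _ ->]; have := valP j.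
      by rewrite !inE/= => /andP[_ /set_mem].
    apply: fsubset_leq_card; apply/fsubsetP => t /bigfcupP[i].
    rewrite andbT => /imfsetP[/= j jK ->] tA.
    by apply/bigfcupP; exists j; rewrite ?mem_index_enum.
  exists (fun i => omap f (insub i)) => i iJ Di.
  have iJD : i \in JD by rewrite !inE iJ mem_set.
  rewrite insubT/=; split; first by exists (f (Sub i iJD)) => //; apply: fA.
  move=> j jJ Dj; have jJD : j \in JD by rewrite !inE jJ mem_set.
  by rewrite insubT/= => -[] /injf [].
have [M MP] := choice sel.
pose above (J0 : {fset I}) : set {fset I} := [set J | J0 `<=` J]%fset.
have aboveF : ProperFilter (filter_from setT above).
  apply: filter_from_proper; last by move=> J _; exists J; exact: fsubset_refl.
  apply: filter_from_filter; first by exists fset0.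
  move=> J1 J2 _ _; exists (J1 `|` J2)%fset => // J /=.
  by rewrite /above /= fsubUset => /andP[].
have [F [FU Fabove]] := ultraFilterLemma aboveF.
have FF : ProperFilter F by exact: ultra_proper.
have FJ i : F [set J | i \in J].
  by apply: Fabove; exists [fset i]%fset => // J /=; rewrite /above/= fsub1set.
have lim i : exists t, D i -> t \in A i /\ F [set J | M J i = Some t].
  have [Di|nDi] := pselect (D i); last by exists t0.
  have [|u] := @ultra_finite _ _ F [fset Some t | t in A i]%fset
      (fun J => M J i) FU.
    apply: filterS (FJ i) => J /= iJ; have [[t -> tA] _] := MP J i iJ Di.
    by apply/imfsetP; exists t.
  by move=> /imfsetP[/= t tA ->] Ft; exists t.
have [f fP] := choice lim.
exists f => [i Di|i j Di Dj fij]; first by have [] := fP i Di.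
have [_ Fi] := fP i Di; have [_ Fj] := fP j Dj.
have : F ([set J | i \in J] `&` [set J | j \in J] `&`
  [set J | M J i = Some (f i)] `&` [set J | M J j = Some (f j)]).
  by do !apply: filterI => //.
move/filter_ex => [J [[[/= iJ jJ] Mi] Mj]].
by have [_] := MP J i iJ Di; apply => //; rewrite Mi Mj fij.
Qed.

(** * Foelner sets from an invariant mean *)

Section folner.
Context (R : realType) (G : groupType) (Y : choiceType) (to : G -> Y -> Y).
Context (S : set Y) (m : set Y -> R).
Hypothesis to1 : forall y, to 1%g y = y.
Hypothesis toM : forall g h y, to (g * h)%g y = to g (to h y).
Hypothesis toS : forall g y, S y -> S (to g y).
Hypothesis mean_m : mean_on S m.
Hypothesis inv_m : forall g A, A `<=` S -> m (to g @` A) = m A.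

Lemma to_inj g : injective (to g).
Proof. by move=> x y /(congr1 (to g^-1%g)); rewrite -!toM mulVg !to1. Qed.

Lemma mean_le A B : A `<=` B -> B `<=` S -> m A <= m B.
Proof.
case: mean_m => _ m_ge0 mU AB BS.
have DS : B `\` A `<=` S by move=> x [/BS].
rewrite -(setDUK AB) mU ?setDIK//; last exact: subset_trans BS.
by rewrite lerDl m_ge0.
Qed.

Lemma mean_set0 : m set0 = 0.
Proof.
case: mean_m => _ _ mU; have := mU set0 set0.
by rewrite setU0 set0I => /(_ (@sub0set _ _) (@sub0set _ _) erefl); lra.
Qed.

(** Finite additivity lets an invariant mean ignore any injection that moves
    each point by one of finitely many group elements. *)
Lemma mean_piecewise (W : seq G) (f : Y -> Y) (A : set Y) :
    A `<=` S -> (forall x y, A x -> A y -> f x = f y -> x = y) ->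
    (forall y, A y -> exists2 w, w \in W & f y = to w y) ->
  m (f @` A) = m A.
Proof.
case: mean_m => _ _ mU; elim: W A => [|w W IHW] A AS finj fW.
  have -> : A = set0 by rewrite -subset0 => y /fW[].
  by rewrite image_set0.
pose B := A `&` [set y | f y = to w y].
have BA : B `<=` A by move=> y [].
have fBS C : C `<=` A -> f @` C `<=` S.
  by move=> CA _ [y /CA Ay <-]; have [v _ ->] := fW _ Ay; apply/toS/AS.
have DA : A `\` B `<=` A by move=> y [].
have mB : m (f @` B) = m B.
  rewrite -[RHS](inv_m w); last exact: subset_trans AS.
  by congr m; apply: eq_imagel => y [].
have mD : m (f @` (A `\` B)) = m (A `\` B).
  apply: IHW; first exact: subset_trans AS.
    by move=> x y /DA Ax /DA Ay; apply: finj.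
  move=> y [Ay nB]; have [v] := fW _ Ay.
  rewrite inE => /orP[/eqP -> fy|vW fy]; last by exists v.
  by exfalso; apply: nB.
rewrite -(setDUK BA) image_setU mU; first last.
- rewrite -subset0 => _ [[x Bx <-] [y [Ay nB] fyx]]; apply: nB.
  by rewrite (finj y x) //; apply: BA.
- exact: fBS.
- exact: fBS.
rewrite mB mD -mU ?setDIK//; apply: subset_trans AS => //.
Qed.

Definition spread (W : seq G) (F : {fset Y}) : {fset Y} :=
  [fset z in [seq to w y | w <- W, y <- F]]%fset.

Lemma mem_spread W F z :
  reflect (exists w, exists2 y, (w \in W) && (y \in F) & z = to w y)
    (z \in spread W F).
Proof.
rewrite inE /=; apply: (iffP allpairsP) => [[[w y] [/= wW yF ->]]|].
  by exists w, y => //; rewrite wW.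
by move=> [w [y /andP[wW yF] ->]]; exists (w, y).
Qed.

(** Tarski's argument: if every finite set at least doubled, Hall's theorem
    would give two injections with disjoint images, each moving points by
    elements of [W], so that the mean of [S] would be at least twice itself. *)
Lemma non_doubling (W : seq G) :
  exists2 F : {fset Y}, [set` F] `<=` S & (#|` spread W F| < 2 * #|` F|)%N.
Proof.
apply: contrapT => noF.
have dbl (F : {fset Y}) : [set` F] `<=` S -> (2 * #|` F| <= #|` spread W F|)%N.
  by move=> FS; rewrite leqNgt; apply/negP => ltF; apply: noF; exists F.
have [mS m_ge0 mU] := mean_m.
have [y0 Sy0] : S !=set0.
  apply/set0P/negP => /eqP S0; move: mS; rewrite S0 mean_set0 => /eqP.
  by rewrite eq_sym oner_eq0.
pose D : set (Y * bool) := [set yb | S yb.1].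
pose A (yb : Y * bool) := [fset to w yb.1 | w in W]%fset.
have [|f fA finj] := @hall _ _ y0 D A.
  move=> J JD; pose F := [fset yb.1 | yb in J]%fset.
  have FS : [set` F] `<=` S by move=> _ /imfsetP[/= yb /JD Dyb ->].
  have JF : (#|` J| <= 2 * #|` F|)%N.
    pose Fb b := [fset ((y, b) : Y * bool) | y in F]%fset.
    have : (J `<=` Fb true `|` Fb false)%fset.
      apply/fsubsetP => -[y b] yJ; have yF : y \in F.
        by apply/imfsetP; exists (y, b).
      by rewrite inE; case: b {yJ}; apply/orP; [left|right];
         apply/imfsetP; exists y.
    move=> /fsubset_leq_card le; apply: leq_trans le _.
    rewrite cardfsU (leq_trans (leq_subr _ _))// mul2n -addnn.
    by rewrite leq_add//; exact: leq_imfset_card.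
  apply: leq_trans JF (leq_trans (dbl F FS) _).
  apply: fsubset_leq_card; apply/fsubsetP => z /mem_spread[w [y /andP[wW]]].
  move=> /imfsetP[/= yb ybJ ->] ->; apply/bigfcupP; exists yb.
    by rewrite andbT.
  by apply/imfsetP; exists w.
pose h b y := f (y, b).
have hW b y : S y -> exists2 w, w \in W & h b y = to w y.
  by move=> Sy; have /imfsetP[w /= wW hE] := fA (y, b) Sy; exists w.
have hm b : m (h b @` S) = 1.
  rewrite -mS; apply: (@mean_piecewise W) => // [x y Sx Sy|y Sy].
    by move=> /finj -/(_ Sx Sy)[].
  exact: hW.
have hS b : h b @` S `<=` S by move=> _ [y Sy <-]; have [w _ ->] := hW b y Sy; exact: toS.
have disj : h true @` S `&` h false @` S = set0.
  rewrite -subset0 => _ [[x Sx <-] [y Sy /finj -/(_ Sy Sx)[]]]//.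
have := @mean_le (h true @` S `|` h false @` S) S.
rewrite mU// !hm mS subUset => /(_ (conj (hS _) (hS _)) (@subset_refl _ _)).
lra.
Qed.

(** Since no set of words doubles all finite sets, growth by a factor [1 + e]
    at each of [r >= e^-1] steps is impossible; a step at which it fails is a
    Foelner set. *)
Lemma folner_set (K : seq G) (e : R) : 0 < e ->
  exists F : {fset Y}, [/\ [set` F] `<=` S, (0 < #|` F|)%N &
    forall k, k \in K ->
      #|` [fset y in F | to k y \notin F]%fset|%:R <= e * #|` F|%:R].
Proof.
move=> e0.
pose step (W : seq G) := [seq (k * w)%g | k <- 1%g :: K, w <- W].
pose words r := iter r step [:: 1%g].
pose r := Num.bound e^-1.
have re : 1 <= r%:R * e.
  by rewrite -ler_pdivrMr// mul1r ltW// archi_boundP// invr_ge0 ltW.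
have [F0 F0S ltF0] := non_doubling (words r).
pose F j := spread (words j) F0.
have FE j k z : k \in 1%g :: K -> z \in F j -> to k z \in F j.+1.
  move=> kK /mem_spread[w [y /andP[wW yF] ->]]; apply/mem_spread.
  exists (k * w)%g, y; last by rewrite toM.
  by rewrite yF andbT /words iterS; apply/allpairsP; exists (k, w).
have Fsub j : (F j `<=` F j.+1)%fset.
  by apply/fsubsetP => z /(FE j 1%g); rewrite to1 inE eqxx; apply.
have FS j : [set` F j] `<=` S.
  by move=> _ /mem_spread[w [y /andP[_ /F0S Sy] ->]]; exact: toS.
have F00 : F 0%N = F0.
  apply/fsetP => z; apply/mem_spread/idP => [[w [y /andP[]]]|zF].
    by rewrite inE => /eqP -> yF ->; rewrite to1.
  by exists 1%g, z; rewrite ?to1// inE eqxx.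
have F0_gt0 : (0 < #|` F0|)%N.
  by rewrite lt0n; apply/negP => /eqP F0E; move: ltF0; rewrite F0E muln0 ltn0.
have leF0 j : (#|` F0| <= #|` F j|)%N.
  elim: j => [|j IHj]; first by rewrite F00.
  exact: leq_trans IHj (fsubset_leq_card (Fsub j)).
have [j lej] : exists j, #|` F j.+1|%:R <= (1 + e) * #|` F j|%:R.
  apply: contrapT => /forallNP noj.
  have grow j : (1 + j%:R * e) * #|` F0|%:R <= #|` F j|%:R.
    elim: j => [|j IHj]; first by rewrite mul0r addr0 mul1r F00.
    have /negP := noj j; rewrite -ltNge => /ltW; apply: le_trans.
    have : #|` F0|%:R <= #|` F j|%:R :> R by rewrite ler_nat.
    rewrite -natr1; nra.
  have := grow r; move: ltF0; rewrite -/(F r) -(ltr_nat R) natrM.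
  have : 0 < #|` F0|%:R :> R by rewrite ltr0n.
  nra.
exists (F j); split; first exact: FS.
  exact: leq_trans F0_gt0 (leF0 j).
move=> k kK.
have inB (A : {fset Y}) (P : pred Y) y :
    (y \in [fset z in A | P z]%fset) = (y \in A) && P y by rewrite !inE.
have [B BE] : {B : {fset Y} | B = [fset y in F j | to k y \notin F j]%fset}.
  by exists [fset y in F j | to k y \notin F j]%fset.
rewrite -BE.
(* the images of the escaping points are new points of the next spread *)
have : (#|` F j| + #|` B| <= #|` F j.+1|)%N.
  have -> : #|` B| = #|` [fset to k y | y in B]%fset|.
    by rewrite card_imfset//; exact: to_inj.
  have disj : [disjoint F j & [fset to k y | y in B]]%fset.
    apply/fdisjointP => z zF; apply/negP => /imfsetP[/= y].
    by rewrite BE inB => /andP[_ ny] zE; move: ny; rewrite -zE zF.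
  rewrite -[X in (X <= _)%N](_ : #|` F j `|` [fset to k y | y in B]|%fset = _).
    apply: fsubset_leq_card; rewrite fsubUset Fsub/=.
    apply/fsubsetP => _ /imfsetP[/= y + ->]; rewrite BE inB => /andP[yF _].
    by apply: FE => //; rewrite inE kK orbT.
  by rewrite cardfsU disjoint_fsetI0 ?cardfs0 ?subn0.
rewrite -(ler_nat R) natrD; lra.
Qed.

End folner.

(** The form in which the Foelner condition is used: representatives [s] of
    finitely many cosets, on most of which left translation by [k] acts, up to
    [L], as an injection [t].  Only injectivity on the good indices is stated,
    as one-sided estimates suffice for measure-preserving actions. *)
Lemma folner_cosets (R : realType) (G : groupType) (L : set G)
    (K : seq G) (e : R) :
  subgroup L -> coamenable R L -> 0 < e ->
  exists (C : finType) (s : C -> G), (0 < #|C|)%N /\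
    forall k, k \in K -> exists (good : pred C) (t : C -> C),
      [/\ {in good &, injective t},
          forall c, good c -> L ((s (t c))^-1 * (k * s c))%g &
          #|[pred c | ~~ good c]|%:R <= e * #|C|%:R].
Proof.
move=> subL [m mean_m inv_m] e0.
have ltr1 (A : set G) : ltranslate 1%g A = A.
  by rewrite /ltranslate; under eq_imagel do rewrite mul1g; rewrite image_id.
have ltrM g h (A : set G) :
    ltranslate (g * h)%g A = ltranslate g (ltranslate h A).
  rewrite /ltranslate image_comp; apply: eq_imagel => x _.
  by rewrite /= mulgA.
have ltrS k (A : set G) :
    coset_space L A -> coset_space L (ltranslate k A).
  by move=> [h _ <-]; exists (k * h)%g.
have [F [FS F0 FK]] := @folner_set R G (set G) (@ltranslate G) _ m
  ltr1 ltrM ltrS mean_m inv_m K e e0.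
have rep (c : F) : exists g, ltranslate g L = val c.
  by have [g _ gE] := FS _ (valP c); exists g.
have [s sE] := choice rep.
exists F, s; split; first by rewrite -cardfE.
move=> k kK.
exists (fun c => ltranslate k (val c) \in F),
  (fun c => odflt c (insub (ltranslate k (val c)))); split.
- move=> c c' ck c'k; rewrite !insubT/= => -[] /= ckE.
  apply: val_inj; rewrite -[LHS]ltr1 -[RHS]ltr1 -(mulVg k) !ltrM.
  by rewrite ckE.
- move=> c ck; rewrite insubT/=.
  have tE : ltranslate (s (Sub (ltranslate k (val c)) ck)) L =
      ltranslate (k * s c)%g L by rewrite sE SubK ltrM sE.
  have [L1 _] := subL.
  have : ltranslate (k * s c)%g L (k * s c)%g.
    by exists 1%g; rewrite ?mulg1//; exact: set_mem.
  by rewrite -tE => -[x Lx <-]; rewrite mulKg.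
- rewrite -cardfE; apply: le_trans (_ : _ <= _) (FK k kK); rewrite ler_nat.
  set Z := [pred c | _].
  have <- : #|` [fset val c | c in Z]%fset| = #|Z|.
    by rewrite card_imfset /= -?cardE//; exact: val_inj.
  apply: fsubset_leq_card; apply/fsubsetP => _ /imfsetP[/= c cZ ->].
  by rewrite !inE (valP c).
Qed.

(** * Comparing sums of probabilities *)

Section probability_calculus.
Context (R : realType) (d : measure_display) (X : measurableType d).
Context (mu : probability X R).
Implicit Types (A B C : set X) (f g : X -> R).

Definition Pr A : R := fine (mu A).

Lemma PrE A : measurable A -> mu A = (Pr A)%:E.
Proof. by move=> mA; rewrite fineK// fin_num_measure. Qed.

Lemma Pr_ge0 A : 0 <= Pr A.
Proof. exact: fine_ge0. Qed.

Lemma Pr_le1 A : measurable A -> Pr A <= 1.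
Proof. by move=> mA; rewrite -lee_fin -PrE// probability_le1. Qed.

Lemma Pr_set0 : Pr set0 = 0.
Proof. by rewrite /Pr measure0. Qed.

Lemma Pr_le A B : measurable A -> measurable B -> A `<=` B -> Pr A <= Pr B.
Proof.
by move=> mA mB AB; rewrite -lee_fin -!PrE// le_measure// inE.
Qed.

Lemma PrU A B : measurable A -> measurable B -> A `&` B = set0 ->
  Pr (A `|` B) = Pr A + Pr B.
Proof.
move=> mA mB AB; apply: EFin_inj; rewrite EFinD -!PrE//.
  by rewrite measureU.
exact: measurableU.
Qed.

Lemma Pr_leU A B : measurable A -> measurable B ->
  Pr (A `|` B) <= Pr A + Pr B.
Proof.
move=> mA mB; have mD : measurable (B `\` A) by exact: measurableD.
have -> : A `|` B = A `|` (B `\` A).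
  apply/seteqP; split => x /=; last by tauto.
  by have [] := pselect (A x); tauto.
by rewrite PrU ?setDIK// lerD2l Pr_le//; exact: subDsetl.
Qed.

Lemma PrD A B : measurable A -> measurable B -> A `<=` B ->
  Pr (B `\` A) = Pr B - Pr A.
Proof.
move=> mA mB AB; rewrite -[in RHS](setDUK AB) PrU ?setDIK//.
  by rewrite addrAC subrr add0r.
exact: measurableD.
Qed.

Lemma measurable_setY A B : measurable A -> measurable B ->
  measurable (A `+` B).
Proof. by move=> mA mB; apply: measurableU; exact: measurableD. Qed.

Lemma Pr_split A B : measurable A -> measurable B ->
  Pr A = Pr (A `\` B) + Pr (A `&` B).
Proof.
move=> mA mB; rewrite -PrU; last by apply/seteqP; split => x //= [[_ ?] []].
- by rewrite setDE -setIUr setUC setUv setIT.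
- exact: measurableD.
- exact: measurableI.
Qed.

Lemma PrT : Pr setT = 1.
Proof. by rewrite /Pr probability_setT. Qed.

(** Inequalities between sums of probabilities are obtained by comparing sums
    of indicators pointwise; this predicate bundles the integrability that the
    comparison needs. *)
Definition has_integral f (v : R) :=
  mu.-integrable setT (EFin \o f) /\ (\int[mu]_x (f x)%:E = v%:E)%E.

Lemma has_integral_indic A : measurable A -> has_integral \1_A (Pr A).
Proof.
move=> mA; split; last first.
  by rewrite -PrE// -[in RHS](setIT A) -integral_indic.
exact: integrable_indic.
Qed.

Lemma has_integral0 : has_integral (fun=> 0) 0.
Proof. by split; [exact: integrable0|rewrite integral0]. Qed.

Lemma has_integralD f g v w : has_integral f v -> has_integral g w ->
  has_integral (fun x => f x + g x) (v + w).
Proof.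
move=> [fi fv] [gi gw]; split; first exact: (integrableD measurableT fi gi).
by rewrite [LHS](integralD measurableT fi gi) fv gw.
Qed.

Lemma has_integral_sum (I : Type) (r : seq I) (p : pred I)
    (f : I -> X -> R) (v : I -> R) :
  (forall i, p i -> has_integral (f i) (v i)) ->
  has_integral (fun x => \sum_(i <- r | p i) f i x) (\sum_(i <- r | p i) v i).
Proof.
move=> fv; elim: r => [|i r IHr].
  by rewrite big_nil; under eq_fun do rewrite big_nil; exact: has_integral0.
rewrite big_cons; under eq_fun do rewrite big_cons.
by case: ifP => // /fv fi; exact: has_integralD.
Qed.

Lemma has_integral_le f g v w : has_integral f v -> has_integral g w ->
  (forall x, f x <= g x) -> v <= w.
Proof.
move=> [fi fv] [gi gw] fg; rewrite -lee_fin -fv -gw.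
by apply: le_integral => // x _; rewrite lee_fin.
Qed.

Lemma measurable_gt f v (r : R) : has_integral f v ->
  measurable [set x | r < f x].
Proof.
move=> [/measurable_int/measurable_EFinP mf _].
have := mf measurableT `]r, +oo[%classic (measurable_itv _).
by rewrite setTI; congr measurable; apply/seteqP; split => x /=;
  rewrite in_itv/= andbT.
Qed.

Definition union_over (I : finType) (W : I -> set X) (T : {set I}) : set X :=
  \bigcup_(i in [set` T]) W i.

Lemma measurable_union_over (I : finType) (W : I -> set X) (T : {set I}) :
  (forall i, measurable (W i)) -> measurable (union_over W T).
Proof. by move=> mW; apply: fin_bigcup_measurable. Qed.

(** A finite exhaustion.  Each new set [W e] is charged [b e] against the mass
    that it adds to the current union; as long as the charge is on average at
    most [C] times the added mass, some [e] achieves that ratio, so the union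
    can grow until it reaches the target mass [t] up to the size [h] of one
    piece. *)
Lemma greedy_union (J : finType) (W : J -> set X) (b : J -> R) (t h C : R) :
    (forall e, measurable (W e)) -> (forall e, Pr (W e) <= h) -> 0 <= t ->
    (forall e, 0 <= b e) ->
    (forall T : {set J}, Pr (union_over W T) <= t ->
       0 < \sum_e Pr (W e `\` union_over W T) /\
       \sum_e b e <= C * \sum_e Pr (W e `\` union_over W T)) ->
  exists T : {set J}, t - h <= Pr (union_over W T) <= t /\
    \sum_(e in T) b e <= C * Pr (union_over W T).
Proof.
move=> mW Wh t0 b0 avg.
pose good (T : {set J}) := (Pr (union_over W T) <= t) &&
  (\sum_(e in T) b e <= C * Pr (union_over W T)).
have good0 : good (finset.set0).
  rewrite /good /union_over (_ : [set` finset.set0] = set0); last first.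
    by rewrite -subset0 => x /=; rewrite inE.
  by rewrite bigcup_set0 Pr_set0 mulr0 t0 big_set0 /=.
have [T /andP[Tt Tb] Tmax] := arg_maxnP (fun T : {set J} => #|T|) good0.
exists T; rewrite Tt andbT; split=> //; rewrite leNgt; apply/negP => ltT.
have [pos le] := avg T Tt; set U := union_over W T in Tt Tb ltT pos le.
have mU : measurable U by exact: measurable_union_over.
have mD e : measurable (W e `\` U) by exact: measurableD.
have [e /andP[epos eb]] : exists e,
    (0 < Pr (W e `\` U)) && (b e <= C * Pr (W e `\` U)).
  apply/not_existsP => none; move: le; apply/negP; rewrite -ltNge mulr_sumr.
  have [e _ epos] : exists2 e, true & 0 < Pr (W e `\` U).
    apply: contrapT => none'; move: pos; rewrite big1 ?ltxx// => e _.
    apply/eqP; rewrite eq_le Pr_ge0 andbT leNgt; apply/negP => epos.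
    by apply: none'; exists e.
  rewrite (bigD1 e)//= [ltRHS](bigD1 e)//= ltr_leD//.
    by have /negP := none e; rewrite epos /= -ltNge.
  apply: ler_sum => i _; have /negP := none i; rewrite negb_and => /orP[].
    rewrite -leNgt => le0; rewrite (_ : Pr _ = 0) ?mulr0//.
    by apply/eqP; rewrite eq_le le0 Pr_ge0.
  by rewrite -ltNge => /ltW.
have eT : e \notin T.
  apply/negP => eT; move: epos; rewrite (_ : _ `\` _ = set0) ?Pr_set0 ?ltxx//.
  by rewrite -subset0 => x [We]; apply; exists e.
have UE : union_over W (e |: T)%SET = U `|` (W e `\` U).
  apply/seteqP; split=> x.
    move=> [i /=]; rewrite !inE => /orP[/eqP ->|iT] Wx; last by left; exists i.
    by have [] := pselect (U x); [left|right].
  move=> [[i /= iT Wx]|[Wx _]]; first by exists i => //=; rewrite !inE iT orbT.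
  by exists e => //=; rewrite !inE eqxx.
have PU : Pr (union_over W (e |: T)%SET) = Pr U + Pr (W e `\` U).
  by rewrite UE PrU ?setDIK.
have /Tmax : good (e |: T)%SET; last first.
  rewrite /= cardsU1 eT add1n => /leq_trans /(_ (leqnn _)).
  by rewrite ltnn.
rewrite /good PU big_setU1//=; apply/andP; split.
  have : Pr (W e `\` U) <= h.
    by apply: le_trans (Wh e); apply: Pr_le => //; exact: subDsetl.
  by move: ltT; lra.
by move: Tb eb; rewrite mulrDr; lra.
Qed.

Lemma cvg_mu0 (A : nat -> set X) : (forall n, measurable (A n)) ->
  mu (A n) @[n --> \oo] --> 0%E <->
  (forall e, 0 < e -> \forall n \near \oo, Pr (A n) < e).
Proof.
move=> mA; rewrite (_ : (fun n => mu (A n)) = (fun n => (Pr (A n))%:E)).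
  split=> [/fine_cvgP[_ /cvgrPdist_lt A0] e /A0|A0].
    by apply: filterS => n /=; rewrite sub0r normrN ger0_norm// Pr_ge0.
  apply/cvg_EFin; first by near=> n.
  apply/cvgrPdist_lt => e /A0; apply: filterS => n /=.
  by rewrite sub0r normrN ger0_norm// Pr_ge0.
by apply/funext => n; rewrite PrE.
Unshelve. all: end_near. Qed.

End probability_calculus.

(** * Measure-preserving actions on sets *)

Lemma countable_enum (T : choiceType) (x0 : T) : countable [set: T] ->
  exists e : nat -> T, forall x, exists n, e n = x.
Proof.
move=> /countable_injP[f /in2TT injf].
exists (fun n => xget x0 [set x | f x = n]) => x; exists (f x).
by apply: injf; exact: (@xgetI _ x0 [set y | f y = f x] x).
Qed.

Section actions_on_sets.
Context (R : realType) (G : groupType) (d : measure_display).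
Context (X : measurableType d) (mu : probability X R) (act : G -> X -> X).
Hypothesis pmp : pmp_action mu act.
Implicit Types (A B : set X).
Local Notation P := (Pr mu).

Lemma actK g : cancel (act g) (act g^-1%g).
Proof. by move=> x; rewrite -(pmp_actM pmp) mulVg (pmp_act1 pmp). Qed.

Lemma actVK g : cancel (act g^-1%g) (act g).
Proof. by move=> x; rewrite -(pmp_actM pmp) mulgV (pmp_act1 pmp). Qed.

Lemma act_imageE g A : act g @` A = act g^-1%g @^-1` A.
Proof.
apply/seteqP; split=> [_ [x Ax <-]/=|x /= Ax]; first by rewrite actK.
by exists (act g^-1%g x); rewrite ?actVK.
Qed.

Lemma act_imageP g A x : (act g @` A) x <-> A (act g^-1%g x).
Proof. by rewrite act_imageE. Qed.

Lemma act_imageM g h A : act (g * h)%g @` A = act g @` (act h @` A).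
Proof. by rewrite image_comp; apply: eq_imagel => x _; rewrite /= (pmp_actM pmp). Qed.

Lemma measurable_act g A : measurable A -> measurable (act g @` A).
Proof.
move=> mA; rewrite act_imageE -[X in measurable X]setTI.
exact: (pmp_measurable pmp).
Qed.

Lemma Pr_act g A : measurable A -> P (act g @` A) = P A.
Proof. by move=> mA; rewrite /Pr act_imageE (pmp_preserving pmp). Qed.

Definition defect g A : R := P (act g @` A `\` A).

Lemma measurable_defect g A : measurable A -> measurable (act g @` A `\` A).
Proof. by move=> mA; apply: measurableD => //; exact: measurable_act. Qed.

Lemma defect_ge0 g A : 0 <= defect g A.
Proof. exact: Pr_ge0. Qed.

(** As the action preserves the measure, [A] loses under [g] exactly as much
    mass as it gains: this is why one-sided defects suffice. *)
Lemma Pr_symdiff_act g A : measurable A ->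
  P ((act g @` A) `+` A) = 2 * defect g A.
Proof.
move=> mA; have mgA := measurable_act g mA.
rewrite /setY PrU; last by rewrite -subset0 => x [[? ?] []].
- have := Pr_split mu mgA mA; have := Pr_split mu mA mgA.
  by rewrite Pr_act// /defect setIC; lra.
- exact: measurableD.
- exact: measurableD.
Qed.

Lemma defect_union_over (J : finType) (W : J -> set X) (T : {set J}) g :
  (forall e, measurable (W e)) ->
  defect g (union_over W T) <= \sum_(e in T) defect g (W e).
Proof.
move=> mW; have mU := measurable_union_over T mW.
apply: (has_integral_le (has_integral_indic mu (measurable_defect g mU))).
  apply: has_integral_sum => e _.
  exact: (has_integral_indic mu (measurable_defect g (mW e))).
move=> x; rewrite indicE; case: (boolP (_ \in _)) => [|_]; last exact: sumr_ge0.
rewrite inE => -[/act_imageP [e eT Wx] nU].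
rewrite (bigD1 e)//= indicE mem_set ?lerDl ?sumr_ge0//.
by split; [exact/act_imageP|move=> We; apply: nU; exists e].
Qed.

(** * Level sets of sums of translates *)

Definition multiplicity (C : finType) (A : C -> set X) (x : X) : nat :=
  \sum_c (x \in A c).

Definition level (C : finType) (A : C -> set X) (j : nat) : set X :=
  [set x | (j < multiplicity A x)%N].

Lemma multiplicity_le (C : finType) (A : C -> set X) x :
  (multiplicity A x <= #|C|)%N.
Proof.
by rewrite -sum1_card; apply: leq_sum => c _; exact: leq_b1.
Qed.

Lemma sum_indic (I : Type) (r : seq I) (p : pred I) (A : I -> set X) x :
  \sum_(i <- r | p i) \1_(A i) x =
    (\sum_(i <- r | p i) (x \in A i))%N%:R :> R.
Proof. by rewrite natr_sum; apply: eq_bigr => c _; rewrite indicE. Qed.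

Lemma measurable_level (C : finType) (A : C -> set X) j :
  (forall c, measurable (A c)) -> measurable (level A j).
Proof.
move=> mA.
have hA : has_integral mu (fun x => \sum_c \1_(A c) x) (\sum_c P (A c)).
  by apply: has_integral_sum => c _; exact: has_integral_indic.
have := measurable_gt j%:R hA; congr measurable; apply/seteqP.
by split=> x; rewrite /level /mkset sum_indic ltr_nat.
Qed.

(** Layer-cake formula for the positive part of a difference. *)
Lemma sum_level_diff (C : finType) (A B : C -> set X) x :
  (\sum_(j < #|C|) (x \in level A j `\` level B j) =
    multiplicity A x - multiplicity B x)%N.
Proof.
have := multiplicity_le A x; set a := multiplicity A x.
set b := multiplicity B x; set n := #|C| => an.
have -> : (\sum_(j < n) (x \in level A j `\` level B j) =
    \sum_(j < n) ((j < a) && (b <= j)))%N.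
  apply: eq_bigr => j _; congr nat_of_bool; apply/idP/andP.
    by rewrite inE => -[ja /negP]; rewrite -leqNgt.
  by move=> [ja bj]; rewrite inE; split=> //; apply/negP; rewrite -leqNgt.
rewrite -[in RHS](minn_idPl an) => {an}; elim: n => [|n IHn].
  by rewrite big_ord0; lia.
by rewrite big_ord_recr /= IHn; lia.
Qed.

(** Bad indices of [A] and good indices [c] with [x] in [A c] but not in
    [B (t c)] are the only ones that have no counterpart in [B]. *)
Lemma multiplicity_transfer (C : finType) (A B : C -> set X)
    (good : pred C) (t : C -> C) x : {in good &, injective t} ->
  (multiplicity A x - multiplicity B x <=
    \sum_(c | good c) (x \in A c `\` B (t c)) +
    \sum_(c | ~~ good c) (x \in A c))%N.
Proof.
move=> injt; rewrite leq_subLR /multiplicity (bigID good)/= addnA leq_add2r.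
have tB : (\sum_(c | good c) (x \in B (t c)) <= \sum_c (x \in B c))%N.
  rewrite -(big_imset (fun c => (x \in B c) : nat) injt)/=.
  by rewrite [leqRHS](bigID [in [set t c | c in good]%SET])/= leq_addr.
apply: leq_trans (leq_add tB (leqnn _)); rewrite -big_split/=.
apply: leq_sum => c _; case: (boolP (x \in A c)) => // /set_mem Ac.
case: (boolP (x \in B (t c))) => // /negP nB.
by rewrite [X in (_ < _ + X)%N](_ : _ = 1%N)// mem_set//; split=> // /mem_set.
Qed.

(** Why the level sets of [x |-> #|{c | x \in s c p}|] are nearly [k]-invariant
    when [s] lists representatives of a Foelner set of cosets of [L] and [p] is
    nearly [L]-invariant: up to an element of [L], left translation by [k]
    permutes the good indices, and their contributions cancel. *)
Lemma sum_defect_level (C : finType) (s : C -> G) (good : pred C) (t : C -> C)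
    (k : G) (p : set X) : measurable p -> {in good &, injective t} ->
  \sum_(j < #|C|) defect k (level (fun c => act (s c) @` p) j) <=
    \sum_(c | good c) defect ((s (t c))^-1 * (k * s c))%g p +
    #|[pred c | ~~ good c]|%:R * P p.
Proof.
move=> mp injt.
pose B c := act (s c) @` p; pose A c := act (k * s c)%g @` p.
have mB c : measurable (B c) by exact: measurable_act.
have mA c : measurable (A c) by exact: measurable_act.
have kB j : act k @` level B j = level A j.
  rewrite act_imageE /level /multiplicity; apply/seteqP.
  by split=> x /=; congr (_ < _)%N; apply: eq_bigr => c _; congr nat_of_bool;
    apply/idP/idP; rewrite !inE /A act_imageM act_imageE.
have defE c : defect ((s (t c))^-1 * (k * s c))%g p = P (A c `\` B (t c)).
  rewrite -[LHS](Pr_act (s (t c))); last exact: measurable_defect.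
  congr P; rewrite /A /B; apply/seteqP; split=> x.
    move=> /act_imageP[/act_imageP Ax nx]; split; last by move=> /act_imageP.
    by rewrite act_imageE /= -(pmp_actM pmp) in Ax *; move: Ax;
       rewrite !invgM !invgK -!mulgA mulgV mulg1.
  move=> [Ax nx]; apply/act_imageP; split; last by move=> /act_imageP.
  rewrite act_imageE/= -(pmp_actM pmp); move: Ax; rewrite act_imageE/=.
  by rewrite !invgM !invgK -!mulgA mulgV mulg1.
have le : \sum_(j < #|C|) P (level A j `\` level B j) <=
  \sum_(c | good c) P (A c `\` B (t c)) + \sum_(c | ~~ good c) P (A c).
  apply: (has_integral_le (mu := mu)
    (f := fun x => \sum_(j < #|C|) \1_(level A j `\` level B j) x)
    (g := fun x => \sum_(c | good c) \1_(A c `\` B (t c)) x +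
                   \sum_(c | ~~ good c) \1_(A c) x)) => [||x].
  - apply: has_integral_sum => j _; apply: has_integral_indic.
    by apply: measurableD; exact: measurable_level.
  - apply: has_integralD; apply: has_integral_sum => c _;
    apply: has_integral_indic => //; exact: measurableD.
  - rewrite !sum_indic -natrD ler_nat sum_level_diff.
    exact: multiplicity_transfer.
apply: le_trans (le_trans le _).
  by apply: ler_sum => j _; rewrite /defect kB.
rewrite lerD//; first by apply: ler_sum => c _; rewrite defE.
rewrite (eq_bigr (fun=> P p)) => [|c _]; last by rewrite Pr_act.
by rewrite sumr_const mulr_natl.
Qed.

(** * Thin families of almost invariant sets *)

(** A finite-precision trace of a failure of the theorem: either a diffuse
    invariant part or an ergodic component without strong ergodicity provides
    such families, for one [c] and for all finite lists [l] of elements of [L]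
    and all [k, h > 0]. *)
Record thin_family (l : seq G) (k h c : R) (I : finType) (p : I -> set X) :
    Prop := ThinFamily {
  thin_measurable : forall i, measurable (p i);
  thin_disjoint : forall i j, i != j -> p i `&` p j = set0;
  thin_small : forall i, P (p i) <= h;
  thin_mass : c <= \sum_i P (p i);
  thin_defect : forall g, g \in l -> \sum_i defect g (p i) <= k }.

Lemma sum_disjoint_le1 (I : finType) (p : I -> set X) x :
  (forall i j, i != j -> p i `&` p j = set0) ->
  (\sum_i (x \in p i) <= 1)%N.
Proof.
move=> disj; have [/existsP[i xi]|/existsPn none] := boolP [exists i, x \in p i].
  rewrite (bigD1 i)//= xi big1// => j ji; apply/eqP; rewrite eqb0.
  apply/negP => xj; have := disj _ _ ji; apply/eqP/set0P; exists x.
  by split; exact: set_mem.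
by rewrite big1// => i _; apply/eqP; rewrite eqb0.
Qed.

Lemma sum_Pr_disjoint_le1 (I : finType) (p : I -> set X) :
  (forall i, measurable (p i)) ->
  (forall i j, i != j -> p i `&` p j = set0) -> \sum_i P (p i) <= 1.
Proof.
move=> mp disjp.
have intp : has_integral mu (fun x => \sum_i \1_(p i) x) (\sum_i P (p i)).
  by apply: has_integral_sum => i _; exact: has_integral_indic.
rewrite -(PrT mu).
apply: (has_integral_le intp (has_integral_indic mu measurableT)) => x.
by rewrite sum_indic indicE in_setT ler_nat sum_disjoint_le1.
Qed.

Variable L : set G.
Hypothesis subL : subgroup L.
Hypothesis coamL : coamenable R L.

(** The pieces are the level sets [W (i, j)] of the multiplicities of the
    translates of [p i] along a Foelner set of size [M].  They have total mass
    at least [M * c] but overlap at most [M] times, so as long as their union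
    has mass at most [c / 2], they add [M * c / 2] to it on average, whereas
    their total defect under each [k] is at most [2 * M * a]. *)
Lemma thin_almost_invariant (c : R) :
    0 < c ->
    (forall (l : seq G) (k h : R), (forall g, g \in l -> L g) -> 0 < k ->
       0 < h -> exists (I : finType) (p : I -> set X), thin_family l k h c p) ->
  forall (K : seq G) (e : R), 0 < e ->
  exists Q, [/\ measurable Q, c / 4 <= P Q <= c / 2 &
    forall k, k \in K -> defect k Q <= e].
Proof.
move=> c0 thin K e e0.
pose q : R := (size K)%:R + 1.
have q0 : 0 < q by rewrite ltr_wpDl.
(* [a] bounds both the Foelner constant and the total defect of the pieces;
   its value makes the ratio of defect to gain at most [e] for [size K] elements *)
pose a := c * e / (4 * q).
have a0 : 0 < a by rewrite /a divr_gt0 ?mulr_gt0.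
have [C [s [C0 fol]]] := folner_cosets K subL coamL a0.
have {}fol k : exists gt : pred C * (C -> C), k \in K ->
    [/\ {in gt.1 &, injective gt.2},
        forall c, gt.1 c -> L ((s (gt.2 c))^-1 * (k * s c))%g &
        #|[pred c | ~~ gt.1 c]|%:R <= a * #|C|%:R].
  have [/fol[g [t gt]]|nk] := boolP (k \in K); first by exists (g, t).
  by exists (xpred0, id) => /negP.
have {fol}[gt gtP] := choice fol.
pose lam k c := ((s ((gt k).2 c))^-1 * (k * s c))%g.
pose l := [seq lam k c | k <- K, c <- [seq c <- enum C | (gt k).1 c]].
have lL g : g \in l -> L g.
  move=> /allpairsPdep[k [x [kK + ->]]]; rewrite mem_filter => /andP[gx _].
  by have [_ + _] := gtP k kK; apply.
pose M : R := #|C|%:R.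
have M0 : 0 < M by rewrite ltr0n.
have sumC (v : R) : \sum_(x : C) v = M * v by rewrite sumr_const mulr_natl.
have h0 : 0 < c / (4 * M) by rewrite divr_gt0// mulr_gt0.
have [I [p [mp disjp smallp massp defp]]] := thin l a _ lL a0 h0.
pose A i x := act (s x) @` p i.
have mA i x : measurable (A i x) by exact: measurable_act.
pose W (ij : I * 'I_#|C|) := level (A ij.1) ij.2.
have mW ij : measurable (W ij) by exact: measurable_level.
pose b ij := \sum_(k <- K) defect k (W ij).
have sump1 : \sum_i P (p i) <= 1 by exact: sum_Pr_disjoint_le1.
have Wh ij : P (W ij) <= c / 4.
  apply: (le_trans (y := \sum_x P (A ij.1 x))).
    have intA : has_integral mu (fun x => \sum_y \1_(A ij.1 y) x)
        (\sum_y P (A ij.1 y)).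
      by apply: has_integral_sum => y _; exact: has_integral_indic.
    apply: (has_integral_le (has_integral_indic mu (mW ij)) intA) => x.
    rewrite sum_indic indicE ler_nat.
    by case: (boolP (_ \in _)) => // /set_mem; apply: leq_ltn_trans.
  rewrite (eq_bigr (fun=> P (p ij.1))) => [|x _]; last by rewrite Pr_act.
  rewrite sumC -ler_pdivlMl//.
  by apply: le_trans (smallp _) _; rewrite invfM mulrA mulrC.
have sumb : \sum_ij b ij <= (size K)%:R * (2 * M * a).
  rewrite exchange_big/= -sum1_size natr_sum mulr_suml big_seq [leRHS]big_seq.
  apply: ler_sum => k kK; rewrite mul1r.
  have [injt Lt bad] := gtP k kK.
  rewrite -(pair_bigA _ (fun i j => defect k (W (i, j))))/=.
  apply: (le_trans (y := \sum_i (\sum_(x | (gt k).1 x) defect (lam k x) (p i) +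
      #|[pred x | ~~ (gt k).1 x]|%:R * P (p i)))).
    by apply: ler_sum => i _; exact: (sum_defect_level s k (mp i) injt).
  rewrite big_split/= -mulr_sumr exchange_big/= -mulrA mulrDl mul1r lerD//.
    apply: (le_trans (y := \sum_(x | (gt k).1 x) a)).
      apply: ler_sum => x gx; apply: defp; apply/allpairsPdep.
      by exists k, x; rewrite mem_filter gx mem_enum.
    rewrite sumr_const -[leLHS]mulr_natl; apply: ler_wpM2r; first exact: ltW.
    by rewrite ler_nat max_card.
  rewrite mulrC -[leRHS]mul1r; apply: ler_pM => //.
    by apply: sumr_ge0 => i _; exact: Pr_ge0.
  by rewrite mulrC.
have t0 : 0 <= c / 2 by rewrite divr_ge0// ltW.
have b0 ij : 0 <= b ij by apply: sumr_ge0 => k _; exact: defect_ge0.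
have [|T [Tt Tb]] := @greedy_union _ _ _ mu _ W b (c / 2) (c / 4) e mW Wh t0 b0;
  last first.
  exists (union_over W T); split.
  - exact: measurable_union_over.
  - by move: Tt => /andP[Tt ->]; rewrite andbT; move: Tt; lra.
  - move=> k kK; apply: le_trans (defect_union_over _ _ mW) _.
    apply: (le_trans (y := \sum_(ij in T) b ij)).
      apply: ler_sum => ij _; rewrite /b (big_rem k)//= lerDl.
      by apply: sumr_ge0 => ? _; exact: defect_ge0.
    apply: le_trans Tb _; rewrite -[leRHS]mulr1.
    apply: ler_wpM2l; first exact: ltW.
    by apply: Pr_le1; exact: measurable_union_over.
move=> T; set U := union_over W T => leU.
have mU : measurable U by exact: measurable_union_over.
have gain : M * (c / 2) <= \sum_ij P (W ij `\` U).
  suff le : \sum_i \sum_x P (A i x) <= \sum_ij P (W ij `\` U) + \sum_(x : C) P U.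
    have : M * c <= \sum_i \sum_x P (A i x).
      rewrite (eq_bigr (fun i => M * P (p i))) => [|i _].
        by rewrite -mulr_sumr; apply: ler_wpM2l => //; exact: ltW.
      rewrite (eq_bigr (fun=> P (p i))) => [|x _]; last by rewrite Pr_act.
      by rewrite sumC.
    have : \sum_(x : C) P U <= M * (c / 2).
      by rewrite sumC; apply: ler_wpM2l => //; exact: ltW.
    by move: le; lra.
  rewrite -(pair_bigA _ (fun i j => P (W (i, j) `\` U)))/=.
  have mD ij : measurable (W ij `\` U) by exact: measurableD.
  have := @has_integral_le _ _ _ mu
    (fun x => \sum_i \sum_y \1_(A i y) x)
    (fun x => \sum_i \sum_j \1_(W (i, j) `\` U) x + \sum_(y : C) \1_U x).
  apply; first 2 last.
  - move=> x; have double (I1 I2 : finType) (D : I1 -> I2 -> set X) :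
        \sum_i \sum_j \1_(D i j) x = (\sum_i \sum_j (x \in D i j))%N%:R :> R.
      by rewrite natr_sum; apply: eq_bigr => i _; exact: sum_indic.
    rewrite !double sum_indic -natrD ler_nat.
    have [/set_mem Ux|nUx] := boolP (x \in U).
      apply: (leq_trans _ (leq_addl _ _)).
      rewrite exchange_big/=; apply: leq_sum => y _.
      apply: sum_disjoint_le1 => i j ij; rewrite /A !act_imageE.
      by rewrite -preimage_setI disjp.
    apply: (leq_trans _ (leq_addr _ _)); apply: leq_sum => i _.
    have m0 : multiplicity (fun _ : C => set0) x = 0%N.
      by rewrite /multiplicity big1// => y _; rewrite in_set0.
    have := sum_level_diff (A i) (fun=> set0) x; rewrite m0 subn0 /multiplicity.
    move=> <-; apply: leq_sum => j _.
    case: (boolP (_ \in _)) => // /set_mem[Wx _].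
    by rewrite lt0b mem_set//; split=> //; move/mem_set; exact/negP.
  - apply: has_integral_sum => i _; apply: has_integral_sum => y _.
    exact: has_integral_indic.
  - apply: has_integralD; last first.
      by apply: has_integral_sum => y _; exact: has_integral_indic.
    apply: has_integral_sum => i _; apply: has_integral_sum => j _.
    exact: has_integral_indic.
have pos : 0 < M * (c / 2) by rewrite mulr_gt0// divr_gt0.
split; first exact: lt_le_trans gain.
apply: le_trans sumb _; apply: (le_trans (y := e * (M * (c / 2)))); last first.
  by rewrite ler_pM2l.
have -> : e * (M * (c / 2)) = q * (2 * M * a).
  have qa : 4 * q * a = c * e by rewrite /a mulrC divfK// mulf_neq0 ?gt_eqF.
  have : M * (4 * q * a) = M * (c * e) by rewrite qa.
  by lra.
rewrite ler_wpM2r//; last by rewrite lerDl.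
exact: ltW (mulr_gt0 (mulr_gt0 (ltr0n _ 2) M0) a0).
Qed.

Hypothesis countG : countable [set: G].
Hypothesis seG : strongly_ergodic act [set: G] [set: X] mu.

(** The set produced from thin families has measure between [c / 4] and
    [c / 2] whatever the precision, which strong ergodicity forbids. *)
Lemma no_thin_families (c : R) : 0 < c ->
  exists (l : seq G) (k h : R), [/\ forall g, g \in l -> L g, 0 < k, 0 < h &
    forall (I : finType) (p : I -> set X), ~ thin_family l k h c p].
Proof.
move=> c0; apply: contrapT => nothin.
have thin (l : seq G) (k h : R) : (forall g, g \in l -> L g) -> 0 < k ->
    0 < h -> exists (I : finType) (p : I -> set X), thin_family l k h c p.
  move=> lL k0 h0; apply: contrapT => none; apply: nothin; exists l, k, h.
  by split=> // I p pth; apply: none; exists I, p.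
have c1 : c <= 1.
  have [|I [p pth]] := thin [::] 1 1 _ ltr01 ltr01; first by [].
  apply: le_trans (thin_mass pth) _; apply: sum_Pr_disjoint_le1.
  - exact: thin_measurable pth.
  - exact: thin_disjoint pth.
have [enumG enumGP] := countable_enum 1%g countG.
pose K n := [seq enumG i | i <- iota 0 n.+1].
have near_inv n : exists Q, [/\ measurable Q, c / 4 <= P Q <= c / 2 &
    forall k, k \in K n -> defect k Q <= n.+1%:R^-1].
  by apply: thin_almost_invariant => //; rewrite invr_gt0 ltr0n.
have [Q QP] := choice near_inv.
have mQ n : measurable (Q n) by have [] := QP n.
have asym g : G -> mu ((act g @` Q n) `+` Q n) @[n --> \oo] --> 0%E.
  move=> _; apply/cvg_mu0 => [n|e e0].
    by apply: measurable_setY => //; exact: measurable_act.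
  have [i gE] := enumGP g.
  near=> n; rewrite Pr_symdiff_act//.
  have [_ _ /(_ g)] := QP n => le.
  have {}le : defect g (Q n) <= n.+1%:R^-1.
    apply: le; apply/mapP; exists i; rewrite ?gE// mem_iota add0n ltnS.
    by near: n; exact: nbhs_infty_ge.
  have : n.+1%:R^-1 < e / 2.
    by near: n; apply: near_infty_natSinv_lt (PosNum (divr_gt0 e0 (ltr0n _ 2))).
  by move/(le_lt_trans le); lra.
have := seG mQ (fun n => @subsetT _ _) (fun g _ => asym g g).
rewrite (_ : (fun n => _) = (fun n => (P (Q n) * (1 - P (Q n)))%:E)); last first.
  by apply/funext => n; rewrite (PrE mu)// -EFinB -EFinM.
move=> /fine_cvgP[_ /cvgrPdist_lt /(_ (c / 8))]; rewrite divr_gt0// => /(_ isT).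
move=> [n _ /(_ n (leqnn n))] /=; rewrite sub0r normrN ltNge => /negP; apply.
apply: le_trans (ler_norm _); have [_ /andP[lo hi] _] := QP n.
have : P (Q n) * (1 / 2) <= P (Q n) * (1 - P (Q n)).
  by apply: ler_wpM2l; [exact: Pr_ge0|lra].
by lra.
Unshelve. all: end_near. Qed.

(** * Compactness of almost invariant sets *)

Lemma Pr_bigsetU_le (I : finType) (D : I -> set X) :
  (forall i, measurable (D i)) -> P (\bigcup_i D i) <= \sum_i P (D i).
Proof.
move=> mD.
have intD : has_integral mu (fun x => \sum_i \1_(D i) x) (\sum_i P (D i)).
  by apply: has_integral_sum => i _; exact: has_integral_indic.
have mU : measurable (\bigcup_i D i) by exact: fin_bigcup_measurable.
apply: (has_integral_le (has_integral_indic mu mU) intD) => x.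
rewrite sum_indic indicE ler_nat.
case: (boolP (_ \in _)) => // /set_mem[i _ Dx].
by rewrite (bigD1 i)//= mem_set.
Qed.

(** Uniform total boundedness of almost invariant sets.  If [N] of them were
    pairwise [e]-distant, consider the partition that they generate: with [N]
    large, two of the sets contain the same large cells, so the symmetric
    difference of these two lies in the small cells, whose total mass is then
    at least [e].  The small cells form a thin family, as a cell loses a point
    only if one of the [N] sets gains or loses it. *)
Lemma close_pair (e : R) : 0 < e ->
  exists (N : nat) (l : seq G) (k : R), [/\ forall g, g \in l -> L g, 0 < k &
    forall E : 'I_N -> set X, (forall j, measurable (E j)) ->
      (forall j g, g \in l -> defect g (E j) <= k) ->
      exists i j, i != j /\ P (E i `+` E j) < e].
Proof.
move=> e0; have [l [k [h [lL k0 h0 nothin]]]] := no_thin_families e0.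
(* at most [b] cells are large, so they have at most [2 ^ b] subsets *)
pose b := Num.bound h^-1; pose N := (2 ^ b).+1.
have N0 : 0 < N%:R :> R by rewrite ltr0n.
exists N, l, (k / (2 * N%:R)); split=> //; first by rewrite divr_gt0// mulr_gt0.
move=> E mE defE; apply: contrapT => far.
have {}far i j : i != j -> e <= P (E i `+` E j).
  by move=> ij; rewrite leNgt; apply/negP => lt; apply: far; exists i, j.
pose sig x : {ffun 'I_N -> bool} := [ffun j => x \in E j].
pose cell s : set X := [set x | sig x = s].
have mcell s : measurable (cell s).
  have -> : cell s = \bigcap_(j in [set: 'I_N]) (if s j then E j else ~` E j).
    apply/seteqP; split=> [x /= <- j _|x /= Ex].
      by rewrite ffunE; case: ifPn => [/set_mem//|/negP nE /mem_set].
    apply/ffunP => j; rewrite ffunE; have := Ex j I.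
    by case: (s j) => [/mem_set//|nE]; apply/negbTE/negP => /set_mem.
  apply: fin_bigcap_measurable => // j _.
  by case: (s j) => //; exact: measurableC.
have dcell s s' : s != s' -> cell s `&` cell s' = set0.
  move=> ss'; rewrite -subset0 => x [/= e1 e2].
  by move: ss'; rewrite -e1 -e2 eqxx.
pose p s := if P (cell s) <= h then cell s else set0.
have mp s : measurable (p s) by rewrite /p; case: ifP.
have dp s s' : s != s' -> p s `&` p s' = set0.
  by move=> ss'; rewrite /p; do 2 case: ifP => _; rewrite ?set0I ?setI0// dcell.
apply: (nothin _ p); split=> //.
- by move=> s; rewrite /p; case: ifP => // _; rewrite Pr_set0 ltW.
- (* few cells are large, so two of the sets [E i] agree on all large cells *)
  pose Big := [set s | h < P (cell s)]%SET.
  have leBig : (#|Big| <= b)%N.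
    rewrite -(ler_nat R); have := sum_Pr_disjoint_le1 mcell dcell.
    have : #|Big|%:R * h <= \sum_s P (cell s).
      rewrite (bigID [in Big])/= -[leLHS]addr0 lerD//; last first.
        by apply: sumr_ge0 => s _; exact: Pr_ge0.
      rewrite mulr_natl -sumr_const; apply: ler_sum => s.
      by rewrite inE => /ltW.
    have : h^-1 < b%:R by apply: archi_boundP; rewrite invr_ge0 ltW.
    rewrite -[X in X < _]mulr1 mulrC ltr_pdivrMr// => bh le1 le2.
    rewrite -(ler_pM2r h0); apply: le_trans le1 (le_trans le2 (ltW bh)).
  pose phi (j : 'I_N) := [set s in Big | s j]%SET.
  have /injectivePn[i [j ij phiij]] : ~~ injectiveb phi.
    apply/negP => /injectiveP injphi.
    have : (#|phi @: 'I_N| <= #|powerset Big|)%N.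
      apply: subset_leq_card; apply/fintype.subsetP => _ /imsetP[j _ ->].
      by rewrite inE; apply/fintype.subsetP => s; rewrite inE => /andP[].
    rewrite card_imset// card_ord card_powerset leqNgt ltnS.
    by rewrite leq_exp2l// leBig.
  apply: le_trans (far i j ij) _.
  have intp : has_integral mu (fun x => \sum_s \1_(p s) x) (\sum_s P (p s)).
    by apply: has_integral_sum => s _; exact: has_integral_indic.
  have mij : measurable (E i `+` E j) by exact: measurable_setY.
  apply: (has_integral_le (has_integral_indic mu mij) intp) => x.
  rewrite sum_indic indicE ler_nat; case: (boolP (_ \in _)) => // /set_mem Exy.
  suff small : P (cell (sig x)) <= h.
    by rewrite (bigD1 (sig x))//= /p small mem_set.
  rewrite leNgt; apply/negP => big.
  have : (sig x \in phi i) = (sig x \in phi j) by rewrite phiij.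
  rewrite !inE big /= !ffunE => xij.
  by case: Exy => -[/mem_set xE]; apply; apply: set_mem; rewrite ?xij// -xij.
- move=> g gl.
  have mY j : measurable (act g @` E j `+` E j).
    by apply: measurable_setY => //; exact: measurable_act.
  have intY : has_integral mu (fun x => \sum_j \1_(act g @` E j `+` E j) x)
      (\sum_j P (act g @` E j `+` E j)).
    by apply: has_integral_sum => j _; exact: has_integral_indic.
  have intp : has_integral mu (fun x => \sum_s \1_(act g @` p s `\` p s) x)
      (\sum_s defect g (p s)).
    by apply: has_integral_sum => s _; apply: has_integral_indic;
       exact: measurable_defect.
  apply: le_trans (has_integral_le intp intY _) _ => [x|].
    rewrite !sum_indic ler_nat; set y := act g^-1%g x.
    have [eqxy|/eqP neqxy] := eqVneq (sig x) (sig y).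
      rewrite big1// => s _; apply/eqP; rewrite eqb0; apply/negP => /set_mem.
      move=> [/act_imageP]; rewrite -/y /p; case: ifP => // _ /= ys; apply.
      by rewrite /cell /= eqxy.
    apply: (@leq_trans 1%N).
      apply: sum_disjoint_le1 => s s' ss'.
      rewrite -subset0 => z [[/act_imageP ps _] [/act_imageP ps' _]].
      have : (p s `&` p s') (act g^-1%g z) by [].
      by rewrite dp.
    rewrite lt0n; apply/negP; rewrite sum_nat_eq0 => /forallP none.
    apply: neqxy; apply/ffunP => j; rewrite !ffunE.
    have := none j; rewrite /= eqb0 => /negP nY; apply/idP/idP => /set_mem xE.
      apply/negPn/negP => /negP yE; apply: nY; apply: mem_set; right.
      by split=> // /act_imageP/mem_set.
    apply/negPn/negP => /negP yE; apply: nY; apply: mem_set; left.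
    by split; [exact/act_imageP|move/mem_set].
  rewrite (eq_bigr (fun j => 2 * defect g (E j))) => [|j _]; last first.
    by rewrite Pr_symdiff_act.
  rewrite -mulr_sumr; apply: (le_trans (y := 2 * \sum_(j < N) k / (2 * N%:R))).
    by apply: ler_wpM2l => //; apply: ler_sum => j _; exact: defE.
  rewrite sumr_const card_ord -[_ *+ N]mulr_natl.
  have -> : 2 * (N%:R * (k / (2 * N%:R))) = k.
    by rewrite mulrA mulrC divfK// mulf_neq0// gt_eqF.
  by [].
Qed.

Lemma Pr_setY_tri A B C : measurable A -> measurable B -> measurable C ->
  P (A `+` C) <= P (A `+` B) + P (B `+` C).
Proof.
move=> mA mB mC.
have mAB := measurable_setY mA mB; have mBC := measurable_setY mB mC.
apply: le_trans (Pr_leU mu mAB mBC); apply: Pr_le => //.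
- exact: measurable_setY.
- exact: measurableU.
- by move=> x; rewrite /setY /=; have [] := pselect (B x); tauto.
Qed.

Lemma Pr_setY_dist A B : measurable A -> measurable B ->
  P A <= P B + P (A `+` B).
Proof.
move=> mA mB; have mAB := measurable_setY mA mB.
apply: le_trans (Pr_leU mu mB mAB); apply: Pr_le => //; first exact: measurableU.
by move=> x; rewrite /setY /=; have [] := pselect (B x); tauto.
Qed.

Lemma Pr_bigcup_le (F : nat -> set X) (v : R) : (forall n, measurable (F n)) ->
  (forall n, P (\bigcup_(i in [set: 'I_n]) F i) <= v) -> P (\bigcup_i F i) <= v.
Proof.
move=> mF le; pose U n := \bigcup_(i in [set: 'I_n]) F i.
have mU n : measurable (U n) by exact: fin_bigcup_measurable.
have UE : \bigcup_n U n = \bigcup_i F i.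
  apply/seteqP; split=> x [n _]; first by move=> [i _ Fx]; exists i.
  by move=> Fx; exists n.+1 => //; exists ord_max.
have mUU : measurable (\bigcup_n U n) by exact: bigcupT_measurable.
have homU : {homo U : n m / (n <= m)%N >-> (n <= m)%O}.
  move=> n m nm; apply/subsetPset => x [i _ Fx].
  by exists (widen_ord nm i).
have cvgU := nondecreasing_cvg_mu (mu := mu) mU mUU homU.
rewrite -UE -lee_fin -PrE// -(cvg_lim _ cvgU)//; apply: lime_le.
  exact: cvgP cvgU.
by apply: nearW => n /=; rewrite (PrE mu (mU n)) lee_fin; exact: le.
Qed.

(** Asymptotic invariance along an ultrafilter forces convergence: by
    [close_pair], for each radius [2 ^- n] some ball is large for the
    ultrafilter, and the limit superior of a sequence picked in these balls is
    the limit. *)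
Lemma ultra_cvg_invariant (T : Type) (F : set_system T) (E : T -> set X) :
    UltraFilter F -> (forall n, measurable (E n)) ->
    (forall g e, L g -> 0 < e -> F [set n | defect g (E n) < e]) ->
  exists A, [/\ measurable A, invariant_set act L A &
    forall e, 0 < e -> F [set n | P (E n `+` A) < e]].
Proof.
move=> FU mE asym; have FF : ProperFilter F by exact: ultra_proper.
have mY n m : measurable (E n `+` E m) by exact: measurable_setY.
have ball (e : R) : 0 < e -> exists n, F [set m | P (E n `+` E m) < e].
  move=> e0; apply: contrapT => noball.
  have far n : F [set m | e <= P (E n `+` E m)].
    have [Fn|] := in_ultra_setVsetC [set m | P (E n `+` E m) < e] FU.
      by exfalso; apply: noball; exists n.
    by apply: filterS => m /= /negP; rewrite -leNgt.
  have [N [l [k [lL k0 close]]]] := close_pair e0.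
  pose good := [set n | forall g, g \in l -> defect g (E n) <= k].
  have Fgood : F good.
    rewrite /good; elim: l lL {close good} => [|g l IHl] lL.
      by apply: filterS filterT => n _ g.
    have Fg := asym g k (lL g (mem_head _ _)) k0.
    have {}IHl := IHl (fun g' g'l => lL g' (mem_behead (s := g :: l) g'l)).
    apply: filterS (filterI Fg IHl) => n [/= gn ln] g'.
    by rewrite inE => /orP[/eqP ->|/ln//]; exact: ltW.
  have [n0 _] := filter_ex Fgood.
  have [f [fgood ffar]] : exists f : nat -> T, (forall i, (i < N)%N -> good (f i)) /\
      forall i j, (i < j < N)%N -> e <= P (E (f i) `+` E (f j)).
    elim: N {close} => [|N [f [fgood ffar]]].
      by exists (fun=> n0); split=> // i j; rewrite ltn0 andbF.
    have Fi : F [set m | forall i : 'I_N, e <= P (E (f i) `+` E m)].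
      by apply: filter_forall => i; exact: far.
    have [m [gm fm]] := filter_ex (filterI Fgood Fi).
    exists (fun i => if (i < N)%N then f i else m); split=> [i|i j /andP[ij]].
      by case: ifP => // iN _; exact: fgood.
    rewrite ltnS => jN; rewrite (leq_trans ij jN).
    case: ifP => jN'; first by apply: ffar; rewrite ij.
    exact: (fm (Ordinal (leq_trans ij jN))).
  have [||i [j [ij]]] := close (fun i => E (f i)).
  - by move=> j.
  - by move=> j g gl; apply: (fgood j (ltn_ord j)).
  - move: ij; rewrite -(inj_eq val_inj) /= neq_ltn => /orP[ij|ij].
      by rewrite ltNge ffar// ij ltn_ord.
    by rewrite setYC ltNge ffar// ij ltn_ord.
pose r n : R := 1 / 2 ^+ n.
have r0 n : 0 < r n by rewrite divr_gt0// exprn_gt0.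
have rS n : r n = 2 * r n.+1.
  by rewrite /r exprS !div1r invfM mulrA divff// mul1r.
have [c cP] := choice (fun n => ball (r n) (r0 n)).
(* [u n] lies in two consecutive balls, so that consecutive terms are close *)
pose V n := [set m | P (E (c n) `+` E m) < r n].
have pick n : exists m, V n m /\ V n.-1 m.
  by have [m mV] := filter_ex (filterI (cP n) (cP n.-1)); exists m.
have [u uV] := choice pick.
pose D n := E (u n) `+` E (u n.+1).
have mD n : measurable (D n) by exact: mY.
have PD n : P (D n) <= 2 * r n.
  have [un _] := uV n; have [_ /= uS] := uV n.+1.
  have := Pr_setY_tri (mE (u n)) (mE (c n)) (mE (u n.+1)).
  rewrite [E (u n) `+` E (c n)]setYC -/(D n).
  by move: un uS; rewrite /V /=; lra.
pose A0 := \bigcap_j \bigcup_k E (u (j + k)%N).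
have mA0 : measurable A0.
  by apply: bigcapT_measurable => j; exact: bigcupT_measurable.
have uA0 n : P (E (u n) `+` A0) <= 4 * r n.
  have sub : E (u n) `+` A0 `<=` \bigcup_k D (n + k)%N.
    move=> x EA; apply: contrapT => nD.
    have Ek k : E (u (n + k)%N) x <-> E (u n) x.
      elim: k => [|k IHk]; first by rewrite addn0.
      rewrite -IHk addnS; have nDk : ~ D (n + k)%N x by move=> Dx; apply: nD; exists k.
      by move: nDk; rewrite /D /setY /=;
        have [] := pselect (E (u (n + k)%N) x);
        have [] := pselect (E (u (n + k).+1) x); tauto.
    suff : A0 x <-> E (u n) x by move: EA; rewrite /setY /=; tauto.
    split=> [/(_ n I)[k _ /Ek//]|En j _].
    by exists n => //; rewrite addnC; exact/Ek.
  apply: (le_trans (y := P (\bigcup_k D (n + k)%N))).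
    by apply: Pr_le => //; [exact: measurable_setY|exact: bigcupT_measurable].
  apply: Pr_bigcup_le => // m; apply: le_trans (Pr_bigsetU_le _) _ => //.
  suff : \sum_(i < m) P (D (n + i)%N) <= 4 * r n - 4 * r (n + m)%N.
    by have := r0 (n + m)%N; lra.
  elim: m => [|m IHm]; first by rewrite big_ord0 addn0 subrr.
  by rewrite big_ord_recr/= addnS; have := PD (n + m)%N; have := rS (n + m)%N; lra.
have A0lim (e : R) : 0 < e -> F [set n | P (E n `+` A0) < e].
  move=> e0; have e60 : 0 < e / 6 by rewrite divr_gt0.
  have [k _ /(_ k (leqnn k)) /= rk] := near_infty_natSinv_expn_lt (PosNum e60).
  apply: filterS (cP k) => m /= cm; have [/= uk _] := uV k.
  have t1 := Pr_setY_tri (mE m) (mE (c k)) mA0.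
  have t2 := Pr_setY_tri (mE (c k)) (mE (u k)) mA0.
  rewrite [E m `+` E (c k)]setYC in t1; rewrite -/(r k) in rk.
  by have := uA0 k; move: t1 t2 rk cm uk; rewrite /V /=; lra.
have inv0 g : L g -> P (act g @` A0 `\` A0) = 0.
  move=> Lg; apply/eqP; rewrite eq_le Pr_ge0 andbT leNgt; apply/negP => pos.
  have pos3 : 0 < P (act g @` A0 `\` A0) / 3 by rewrite divr_gt0.
  have [n [/= n1 n2]] := filter_ex (filterI (A0lim _ pos3) (asym g _ Lg pos3)).
  have mY0 := measurable_setY (mE n) mA0.
  have mdef := measurable_defect g (mE n).
  have sub : act g @` A0 `\` A0 `<=`
      (act g @` (E n `+` A0) `|` (act g @` E n `\` E n)) `|` (E n `+` A0).
    move=> x; rewrite !act_imageE /setY /=.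
    by have [] := pselect (E n x); have [] := pselect (E n (act g^-1%g x)); tauto.
  have mgY := measurable_act g mY0.
  have := Pr_leU mu (measurableU _ _ mgY mdef) mY0.
  have := Pr_leU mu mgY mdef; rewrite Pr_act//.
  have := Pr_le mu (measurable_defect g mA0)
    (measurableU _ _ (measurableU _ _ mgY mdef) mY0) sub.
  by move: n1 n2; rewrite /defect; lra.
(* make the limit exactly invariant by intersecting its translates *)
have [enumG enumGP] := countable_enum 1%g countG.
pose Z n := if enumG n \in L then A0 `\` act (enumG n) @` A0 else set0.
have mZ n : measurable (Z n).
  by rewrite /Z; case: ifP => // _; apply: measurableD => //; exact: measurable_act.
have Z0 n : P (Z n) = 0.
  rewrite /Z; case: ifPn => [/set_mem Lg|_]; last exact: Pr_set0.
  have mg := measurable_act (enumG n) mA0.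
  have := Pr_split mu mg mA0; have := Pr_split mu mA0 mg.
  by rewrite inv0// Pr_act// setIC; lra.
have mZU : measurable (\bigcup_n Z n) by exact: bigcupT_measurable.
have ZU0 : P (\bigcup_n Z n) <= 0.
  apply: Pr_bigcup_le => // n; apply: le_trans (Pr_bigsetU_le _) _ => //.
  by rewrite big1.
have AP x : (A0 `\` \bigcup_n Z n) x <-> forall g, L g -> A0 (act g^-1%g x).
  have [L1 _] := subL; split=> [[A0x nZ] g Lg|Ax].
    apply: contrapT => nA; apply: nZ; have [n gE] := enumGP g; exists n => //.
    by rewrite /Z gE mem_set//; split=> // /act_imageP.
  split; first by have := Ax 1%g (set_mem L1); rewrite invg1 (pmp_act1 pmp).
  move=> [n _]; rewrite /Z; case: ifPn => // /set_mem Lg [_]; apply.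
  by apply/act_imageP; exact: Ax.
exists (A0 `\` \bigcup_n Z n); split.
- exact: measurableD.
- move=> g Lg; have LV := group_closedV subL; have LM := group_closedM subL.
  apply/seteqP; split=> x.
    move=> /act_imageP/AP Ax; apply/AP => h Lh.
    have := Ax (g^-1 * h)%g; rewrite -(pmp_actM pmp) invgM invgK mulgK; apply.
    by apply: set_mem; apply: LM; [apply: LV|]; exact: mem_set.
  move=> /AP Ax; apply/act_imageP/AP => h Lh.
  rewrite -(pmp_actM pmp) -invgM; apply: Ax.
  by apply: set_mem; apply: LM; exact: mem_set.
- move=> e e0; apply: filterS (A0lim e e0) => n /=; apply: le_lt_trans.
  have mA : measurable (A0 `\` \bigcup_n Z n) by exact: measurableD.
  have mY0 := measurable_setY (mE n) mA0.
  have sub : E n `+` (A0 `\` \bigcup_n Z n) `<=` (E n `+` A0) `|` \bigcup_n Z n.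
    by move=> x; rewrite /setY /setD /=; have [] := pselect ((\bigcup_n Z n) x); tauto.
  have := Pr_le mu (measurable_setY (mE n) mA) (measurableU _ _ mY0 mZU) sub.
  by have := Pr_leU mu mY0 mZU; lra.
Qed.

(** Greedy exhaustion: each step takes a set whose measure is at least half the
    supremum of what is available.  Disjointness forces these measures to tend
    to zero, so nothing of positive measure is left. *)
Lemma disjoint_exhaustion (Q : set X -> Prop) :
  (forall A, Q A -> measurable A) ->
  exists F : nat -> set X, [/\ forall n, Q (F n) \/ F n = set0,
    forall i j, i != j -> F i `&` F j = set0 &
    forall A, Q A -> (forall n, A `&` F n = set0) -> P A = 0].
Proof.
move=> mQ.
have pick U : exists A, [/\ Q A \/ A = set0, A `&` U = set0 &
    forall B, Q B -> B `&` U = set0 -> P B <= 2 * P A].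
  pose S := [set P B | B in [set B | Q B /\ B `&` U = set0]].
  have Sub : ubound S 1 by move=> _ [B [QB _] <-]; apply: Pr_le1; exact: mQ.
  have [[B0 [QB0 B0U] B0pos]|none] :=
      pselect (exists2 B, Q B /\ B `&` U = set0 & 0 < P B); last first.
    exists set0; split; rewrite ?set0I//; first by right.
    move=> B QB BU; rewrite Pr_set0 mulr0 leNgt; apply/negP => Bpos.
    by apply: none; exists B.
  have supS : has_sup S by split; [exists (P B0), B0|exists 1].
  have le_sup B : Q B -> B `&` U = set0 -> P B <= sup S.
    by move=> QB BU; apply: ub_le_sup; [exists 1|exists B].
  have sup0 : 0 < sup S / 2 by rewrite divr_gt0//; apply: lt_le_trans (le_sup B0 _ _).
  have [_ [A [QA AU] <-] Alt] := sup_adherent sup0 supS.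
  exists A; split=> //; first by left.
  by move=> B QB BU; have := le_sup B QB BU; move: Alt; lra.
have [a aP] := choice pick.
pose U n := iter n (fun V => V `|` a V) set0.
have US n : U n.+1 = U n `|` a (U n) by [].
have Ule n m : (n <= m)%N -> U n `<=` U m.
  move=> /subnKC <-; elim: (m - n)%N => [|k IHk]; first by rewrite addn0.
  by rewrite addnS US => x /IHk; left.
have disjF i j : (i < j)%N -> a (U i) `&` a (U j) = set0.
  move=> ij; rewrite -subset0 => x [ai aj]; have [_ + _] := aP (U j).
  by move=> <-; split=> //; apply: (Ule _ _ ij); right.
have mF n : measurable (a (U n)).
  by have [[/mQ//|->] _ _] := aP (U n); exact: measurable0.
exists (fun n => a (U n)); split.
- by move=> n; have [] := aP (U n).
- by move=> i j; rewrite neq_ltn => /orP[/disjF//|/disjF]; rewrite setIC.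
move=> A QA AF; apply/eqP; rewrite eq_le Pr_ge0 andbT leNgt; apply/negP => Apos.
have AU n : A `&` U n = set0.
  by elim: n => [|n IHn]; rewrite ?setI0// US setIUr IHn AF setU0.
have big n : P A / 2 <= P (a (U n)).
  by have [_ _ /(_ A QA (AU n))] := aP (U n); lra.
pose N := Num.bound (2 / P A).
have : \sum_(n < N) P (a (U n)) <= 1.
  apply: (@sum_Pr_disjoint_le1 'I_N (fun n => a (U n))) => // i j.
  by rewrite -(inj_eq val_inj) /= neq_ltn => /orP[/disjF//|/disjF]; rewrite setIC.
have : \sum_(n < N) P A / 2 <= \sum_(n < N) P (a (U n)) by exact: ler_sum.
rewrite sumr_const card_ord -[_ *+ N]mulr_natl.
have : 2 / P A < N%:R by apply: archi_boundP; rewrite divr_ge0// ltW.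
by rewrite ltr_pdivrMr//; lra.
Qed.

(** * Ergodic components *)

Definition inv_measurable A : Prop := measurable A /\ invariant_set act L A.

Lemma invariantP A :
  (forall g x, L g -> A x -> A (act g x)) <-> invariant_set act L A.
Proof.
split=> [Ag g Lg|Ainv g x Lg Ax]; last by rewrite -(Ainv g Lg); exists x.
apply/seteqP; split=> [_ [x Ax <-]|x Ax]; first exact: Ag.
apply/act_imageP; apply: Ag => //.
by apply: set_mem; apply: (group_closedV subL); exact: mem_set.
Qed.

Lemma inv_measurableI A B :
  inv_measurable A -> inv_measurable B -> inv_measurable (A `&` B).
Proof.
move=> [mA /invariantP iA] [mB /invariantP iB]; split; first exact: measurableI.
by apply/invariantP => g x Lg [Ax Bx]; split; [exact: iA|exact: iB].
Qed.

Lemma inv_measurableC A : inv_measurable A -> inv_measurable (~` A).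
Proof.
move=> [mA iA]; split; first exact: measurableC.
apply/invariantP => g x Lg nAx; rewrite -(iA g Lg) => /act_imageP.
by rewrite actK.
Qed.

Lemma inv_measurableD A B :
  inv_measurable A -> inv_measurable B -> inv_measurable (A `\` B).
Proof.
by move=> iA iB; rewrite setDE; apply: inv_measurableI => //; exact: inv_measurableC.
Qed.

Lemma inv_measurable_bigcup (F : nat -> set X) :
  (forall n, inv_measurable (F n)) -> inv_measurable (\bigcup_n F n).
Proof.
move=> iF; split; first by apply: bigcupT_measurable => n; have [] := iF n.
apply/invariantP => g x Lg [n _ Fx]; exists n => //.
by have [_ /invariantP] := iF n; apply.
Qed.

Lemma defect_invariant g A : L g -> invariant_set act L A -> defect g A = 0.
Proof. by move=> Lg iA; rewrite /defect iA// setDv Pr_set0. Qed.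

Definition ergodic_component A : Prop := [/\ inv_measurable A, 0 < P A &
  forall B, inv_measurable B -> B `<=` A -> P B = 0 \/ P B = P A].

(** Without components inside [A], every invariant subset of positive measure
    can be halved repeatedly, so exhaustion by invariant subsets of measure at
    most [h] fills [A]; finitely many of them fill half of [A] and form a thin
    family with zero defects. *)
Lemma no_diffuse_part A : inv_measurable A ->
  (forall B, ergodic_component B -> ~ B `<=` A) -> P A = 0.
Proof.
move=> iA noatom; have [mA _] := iA.
apply/eqP; rewrite eq_le Pr_ge0 andbT leNgt; apply/negP => Apos.
have Apos2 : 0 < P A / 2 by rewrite divr_gt0.
have [l [k [h [lL k0 h0 nothin]]]] := no_thin_families Apos2.
pose Q B := [/\ inv_measurable B, B `<=` A & P B <= h].
have [F [QF disjF exF]] : exists F : nat -> set X, [/\ forall n, Q (F n) \/ F n = set0,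
    forall i j, i != j -> F i `&` F j = set0 &
    forall B, Q B -> (forall n, B `&` F n = set0) -> P B = 0].
  by apply: disjoint_exhaustion => B [[]].
have i0 : inv_measurable set0.
  by split; [exact: measurable0|move=> g _; rewrite image_set0].
have iF n : inv_measurable (F n) by have [[]|->] := QF n.
have Fh n : P (F n) <= h by have [[]//|->] := QF n; rewrite Pr_set0 ltW.
have iU := inv_measurable_bigcup iF.
pose A' := A `\` \bigcup_n F n.
have iA' : inv_measurable A' by exact: inv_measurableD.
have A'0 : P A' = 0.
  apply/eqP; rewrite eq_le Pr_ge0 andbT leNgt; apply/negP => A'pos.
  have halve n : exists B, [/\ inv_measurable B, B `<=` A', 0 < P B &
      P B <= P A' * (1 / 2 ^+ n)].
    elim: n => [|n [B [iB BA' Bpos Bn]]].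
      by exists A'; split=> //; rewrite expr0 divr1 mulr1.
    have [C [iC CB C0 CPB]] : exists C, [/\ inv_measurable C, C `<=` B, P C <> 0 &
        P C <> P B].
      apply: contrapT => noC; apply: (noatom B); last by move=> x /BA'[].
      split=> // C iC CB; apply: contrapT => /not_orP[C0 CPB].
      by apply: noC; exists C.
    have [mB _] := iB; have [mC _] := iC.
    have PBC := PrD mu mC mB CB.
    have C_gt0 : 0 < P C by rewrite lt_def Pr_ge0 andbT; apply/eqP.
    have C_lt : P C < P B.
      by rewrite lt_def Pr_le// andbT; apply/eqP => e; apply: CPB.
    have half : 1 / 2 ^+ n = 2 * (1 / 2 ^+ n.+1) :> R.
      by rewrite exprS !div1r invfM mulrA divff// mul1r.
    have [le|lt] := leP (P C) (P B / 2).
      exists C; split=> //; first exact: subset_trans BA'.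
      by move: Bn; rewrite half; lra.
    exists (B `\` C); split; first exact: inv_measurableD.
    - by move=> x [/BA'].
    - by rewrite PBC subr_gt0.
    - by move: Bn; rewrite half PBC; lra.
  have [n _ /(_ n (leqnn n)) /= hn] :=
    near_infty_natSinv_expn_lt (PosNum (divr_gt0 h0 A'pos)).
  have [B [iB BA' Bpos Bn]] := halve n.
  have Bh : P B <= h.
    apply: le_trans Bn _; rewrite mulrC -ler_pdivlMr//; exact: ltW.
  have := exF B; rewrite (_ : P B = 0 <-> False); last first.
    by split=> // e; move: Bpos; rewrite e ltxx.
  apply; first by split=> // x /BA'[].
  by move=> n'; rewrite -subset0 => x [/BA'[_ nF] Fx]; apply: nF; exists n'.
have PU : P A <= P (\bigcup_n F n).
  have [mU _] := iU; have [mA' _] := iA'.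
  have := Pr_leU mu mA' mU; rewrite A'0 add0r; apply: le_trans.
  apply: Pr_le => //; first exact: measurableU.
  by move=> x Ax; have [] := pselect ((\bigcup_n F n) x); [right|left].
have mF n : measurable (F n) by have [] := iF n.
have [n nP] : exists n, P A / 2 < P (\bigcup_(i in [set: 'I_n]) F i).
  apply: contrapT => /forallNP none.
  have : P (\bigcup_n F n) <= P A / 2.
    by apply: Pr_bigcup_le => // n; rewrite leNgt; apply/negP/none.
  by move: PU Apos; lra.
apply: (nothin 'I_n (fun i => F i)); split=> //.
- by move=> i j ij; apply: disjF; rewrite (inj_eq val_inj).
- by apply: le_trans (ltW nP) _; exact: Pr_bigsetU_le.
- move=> g gl; rewrite big1 ?ltW// => i _; apply: defect_invariant.
    exact: lL.
  by have [] := iF i.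
Qed.

Lemma normalized_restrictionE D A : measurable D -> measurable A -> 0 < P D ->
  normalized_restriction mu D A = (P (D `&` A) / P D)%:E.
Proof.
move=> mD mA D0; rewrite /normalized_restriction (PrE mu mD).
rewrite (PrE mu (measurableI _ _ mD mA)) inver gt_eqF//.
Qed.

(** A failure of strong ergodicity gives infinitely many [n] at which
    [v n * (1 - v n)] stays away from zero; along an ultrafilter concentrated
    on these [n] the sets converge to an invariant subset of [D] of measure
    neither zero nor full. *)
Lemma component_strongly_ergodic D : ergodic_component D ->
  strongly_ergodic act L D (normalized_restriction mu D).
Proof.
move=> [iD D0 Datom] E mE ED asym; have [mD invD] := iD.
pose v n := P (E n) / P D.
have nuE n : normalized_restriction mu D (E n) = (v n)%:E.
  rewrite normalized_restrictionE//; congr (P _ / _)%:E.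
  by apply/setIidPr; exact: ED.
have v01 n : 0 <= v n <= 1.
  by rewrite divr_ge0 ?Pr_ge0//= ler_pdivrMr// mul1r Pr_le.
rewrite (_ : (fun n => _) = (fun n => (v n * (1 - v n))%:E)); last first.
  by apply/funext => n; rewrite nuE -EFinB -EFinM.
have asymP g e : L g -> 0 < e -> \forall n \near \oo, defect g (E n) < e.
  move=> Lg e0; have /fine_cvgP[_ /cvgrPdist_lt] := asym g Lg.
  move=> /(_ (e / P D)); rewrite divr_gt0// => /(_ isT); apply: filterS => n /=.
  have mg := measurable_act g (mE n).
  rewrite normalized_restrictionE//; last exact: measurable_setY.
  rewrite /= sub0r normrN ger0_norm ?divr_ge0 ?Pr_ge0//.
  rewrite ltr_pM2r ?invr_gt0//; apply: le_lt_trans; apply: Pr_le.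
  - exact: measurable_defect.
  - by apply: measurableI => //; exact: measurable_setY.
  - move=> x [gEx nEx]; split; last by left.
    by rewrite -(invD g Lg); apply: image_subset gEx; exact: ED.
apply/cvg_EFin; first exact: nearW.
apply/cvgrPdist_lt => e e0; apply: contrapT => notnear.
pose S := [set n | e <= v n * (1 - v n)].
have pS : ProperFilter (within S \oo).
  apply: Build_ProperFilter => S0; apply: notnear; rewrite /within /= in S0.
  apply: filterS S0 => n nS; rewrite sub0r normrN ger0_norm.
    by rewrite ltNge; apply/negP => /nS.
  by have /andP[v0 v1] := v01 n; rewrite mulr_ge0// subr_ge0.
have [F [FU SF]] := ultraFilterLemma pS.
have FF : ProperFilter F by exact: ultra_proper.
have FS : F S by apply: SF; rewrite /within /=; exact: nearW.
have Fasym g r : L g -> 0 < r -> F [set n | defect g (E n) < r].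
  by move=> Lg r0; apply: SF; rewrite /within /=; apply: filterS (asymP g r Lg r0).
have [A [mA invA limA]] := ultra_cvg_invariant FU mE Fasym.
have eD : 0 < e * P D by rewrite mulr_gt0.
have [n [/= Sn An]] := filter_ex (filterI FS (limA _ eD)).
have mAD : measurable (A `&` D) by exact: measurableI.
have close : P (E n `+` (A `&` D)) < e * P D.
  apply: le_lt_trans An; apply: Pr_le; [exact: measurable_setY| |].
    exact: measurable_setY.
  by move=> x; rewrite /setY /=; have := @ED n x; tauto.
have closev : P (E n `+` (A `&` D)) / P D < e by rewrite ltr_pdivrMr.
have /andP[v0 v1] := v01 n.
have [A0|A1] := Datom (A `&` D) (inv_measurableI (conj mA invA) iD) (@subIsetr _ A D).
- have le : v n <= P (E n `+` (A `&` D)) / P D.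
    rewrite ler_pM2r ?invr_gt0//.
    by have := Pr_setY_dist (mE n) mAD; rewrite A0 add0r.
  have : v n * (1 - v n) <= v n by rewrite -[leRHS]mulr1 ler_wpM2l//; lra.
  by move: Sn le closev; rewrite /S /=; lra.
- have le : 1 - v n <= P (E n `+` (A `&` D)) / P D.
    rewrite -[1](divff (lt0r_neq0 D0)) -mulrBl ler_pM2r ?invr_gt0// lerBlDl.
    by rewrite -[in leLHS]A1 setYC Pr_setY_dist.
  have : v n * (1 - v n) <= 1 - v n by rewrite -[leRHS]mul1r ler_wpM2r// subr_ge0.
  by move: Sn le closev; rewrite /S /=; lra.
Qed.

End actions_on_sets.

(** Apply strong ergodicity to constant sequences. *)
Lemma strongly_ergodic_ergodic (R : realType) (G : groupType)
    (d : measure_display) (X : measurableType d) (act : G -> X -> X)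
    (H : set G) (D : set X) (nu : set X -> \bar R) :
  strongly_ergodic act H D nu -> ergodic act H D nu.
Proof.
move=> se A mA AD A0.
have := se (fun=> A) (fun=> mA) (fun=> AD).
have cst0 g : H g -> nu ((act g @` A) `+` A) @[n --> \oo] --> 0%E.
  by move=> Hg; rewrite A0//; exact: cvg_cst.
move=> /(_ cst0) nu0; have : (nu A * (1 - nu A) = 0)%E.
  by rewrite -(cvg_lim (@ereal_hausdorff R) nu0) lim_cst//; exact: ereal_hausdorff.
move/eqP; rewrite mule_eq0 => /orP[/eqP ->|]; first by left.
by case: (nu A) => [r| |]//=; rewrite -EFinB eqe subr_eq0 => /eqP <-; right.
Qed.

Theorem corollary1p4 (R : realType) (G : groupType) (L : set G)
    (countableG : countable [set: G]) (subgroupL : subgroup L)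
    (coamenableL : coamenable R L)
    (d : measure_display) (X : measurableType d) (mu : probability X R)
    (standardX : standard_borel R X)
    (act : G -> X -> X) (pmp_act : pmp_action mu act)
    (strongly_ergodicG : strongly_ergodic act [set: G] [set: X] mu) :
  exists (I : countType) (E : I -> set X),
    [/\ forall i, measurable (E i),
        forall i, (0 < mu (E i))%E,
        forall i, invariant_set act L (E i),
        (forall i j, i <> j -> mu (E i `&` E j) = 0%E) /\
          mu (~` (\bigcup_i E i)) = 0%E &
        forall i,
          ergodic act L (E i) (normalized_restriction mu (E i)) /\
          strongly_ergodic act L (E i) (normalized_restriction mu (E i))].
Proof.
have [F [FC disjF exF]] : exists F : nat -> set X,
    [/\ forall n, ergodic_component mu act L (F n) \/ F n = set0,
      forall i j, i != j -> F i `&` F j = set0 &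
      forall A, ergodic_component mu act L A -> (forall n, A `&` F n = set0) ->
        Pr mu A = 0].
  by apply: disjoint_exhaustion => A [[]].
have iF n : inv_measurable act L (F n).
  by have [[]//|->] := FC n; split=> // g _; rewrite image_set0.
have compF n : 0 < Pr mu (F n) -> ergodic_component mu act L (F n).
  by have [//|->] := FC n; rewrite Pr_set0 ltxx.
have iU := inv_measurable_bigcup pmp_act subgroupL iF.
have rest0 : Pr mu (~` \bigcup_n F n) = 0.
  apply: (no_diffuse_part pmp_act subgroupL coamenableL countableG).
  - exact: strongly_ergodicG.
  - exact: (inv_measurableC pmp_act subgroupL).
  - move=> B compB BU; have [_ + _] := compB; rewrite exF ?ltxx//.
    by move=> n; rewrite -subset0 => x [/BU nU Fx]; apply: nU; exists n.
exists {n : nat | 0 < Pr mu (F n)}, (fun i => F (val i)); split.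
- by move=> i; have [] := iF (val i).
- by move=> i; have [mFi _] := iF (val i); rewrite PrE// lte_fin (valP i).
- by move=> i; have [] := iF (val i).
- split=> [i j ij|].
    by rewrite disjF ?measure0//; apply/eqP => /val_inj.
  have -> : \bigcup_(i : {n : nat | 0 < Pr mu (F n)}) F (val i) = \bigcup_n F n.
    apply/seteqP; split=> x [i _ Fx]; first by exists (val i).
    have posi : 0 < Pr mu (F i).
      by have [[]//|F0] := FC i; move: Fx; rewrite F0.
    by exists (exist _ i posi).
  by have [mU _] := inv_measurableC pmp_act subgroupL iU; rewrite PrE// rest0.
- move=> i; have se := component_strongly_ergodic pmp_act subgroupL coamenableL
    countableG strongly_ergodicG (compF _ (valP i)).
  by split=> //; exact: strongly_ergodic_ergodic.
Qed.
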